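(* For fixed real $s\geq1$, the inequality \[ \operatorname{Tr} f(A)A^sB^s\geq\operatorname{Tr} f(A)(A^{1/2}BA^{1/2})^s \] holds for all positive semidefinite complex matrices $A,B$ of the same size in all finite dimensions and all nonnegative nondecreasing functions $f$ on an interval containing $\operatorname{spec}(A)$ if and only if $1\leq s\leq2$. Moreover, the full monotone-weight picture is as follows, where $A,B$ are positive semidefinite matrices of the same finite size and $f$ is a nonnegative nondecreasing function on an interval containing $\operatorname{spec}(A)$: - if $0\leq s\leq1$, then $\operatorname{Tr} f(A)A^sB^s\leq\operatorname{Tr} f(A)(A^{1/2}BA^{1/2})^s$ for all such $A,B,f$; - if $1\leq s\leq2$, then $\operatorname{Tr} f(A)A^sB^s\geq\operatorname{Tr} f(A)(A^{1/2}BA^{1/2})^s$ for all such $A,B,f$; - if $s>2$, then the inequality $\operatorname{Tr} f(A)A^sB^s\geq\operatorname{Tr} f(A)(A^{1/2}BA^{1/2})^s$ fails in general already in dimension $3$, i.e. for some $3\times3$ such $A,B$ and some such $f$.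
   Context: Powers and functions of Hermitian matrices are taken by the functional calculus, with $X^0=I$; $\operatorname{spec}(A)$ is the set of eigenvalues of $A$. *)

(* Defs.v *)
From HB Require Import structures.
From mathcomp Require Import all_boot all_order all_algebra.
From mathcomp Require Import sesquilinear spectral.
From mathcomp Require Import all_classical all_reals all_analysis.
From mathcomp Require Import complex.

Set Implicit Arguments.
Unset Strict Implicit.
Unset Printing Implicit Defensive.

Import Order.TTheory GRing.Theory Num.Theory.

Local Open Scope classical_set_scope.
Local Open Scope ring_scope.
Local Open Scope complex_scope.
Local Open Scope sesquilinear_scope.

(* In the partial order of R[i], [0 <= z] means that z is real and
   nonnegative. *)
Definition psdmx (R : realType) (n : nat) (A : 'M[R[i]]_n) : Prop :=
  A \is hermsymmx /\ forall v : 'cV[R[i]]_n, 0 <= (v^t* *m A *m v) 0 0.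

Definition spec (R : realType) (n : nat) (A : 'M[R[i]]_n) : set R[i] :=
  [set z | eigenvalue A z].

(* Functional calculus for a Hermitian A = U^-1 D U, with U unitary and D real
   diagonal.  The function f is total, but only its values on spec A matter. *)
Definition mxfun (R : realType) (n : nat) (f : R -> R) (A : 'M[R[i]]_n) :
    'M[R[i]]_n :=
  let U := spectralmx A in
  invmx U *m diag_mx (map_mx (fun z => (f (complex.Re z))%:C) (spectral_diag A))
    *m U.

(* [powR] has 0 `^ 0 = 1, whence mxpowR A 0 = 1. *)
Definition mxpowR (R : realType) (n : nat) (A : 'M[R[i]]_n) (s : R) :
    'M[R[i]]_n :=
  mxfun (fun x => x `^ s) A.

(* The data (A, B, f) ranged over: f is a nonnegative nondecreasing function on
   the interval J, which contains spec A. *)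
Definition admissible (R : realType) (n : nat) (A B : 'M[R[i]]_n)
    (J : interval R) (f : R -> R) : Prop :=
  [/\ psdmx A, psdmx B,
      spec A `<=` [set x%:C | x in [set` J]],
      {in J, forall x, 0 <= f x} &
      {in J &, {homo f : x y / x <= y}}].

Definition tr_prod (R : realType) (n : nat) (s : R) (A B : 'M[R[i]]_n)
    (f : R -> R) : R[i] :=
  \tr (mxfun f A *m mxpowR A s *m mxpowR B s).

Definition tr_sandwich (R : realType) (n : nat) (s : R) (A B : 'M[R[i]]_n)
    (f : R -> R) : R[i] :=
  \tr (mxfun f A *m mxpowR (mxpowR A 2^-1 *m B *m mxpowR A 2^-1) s).

(* Main.v *)
Require Import Defs.
From HB Require Import structures.
From mathcomp Require Import all_boot all_order all_algebra.
From mathcomp Require Import sesquilinear spectral.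
From mathcomp Require Import all_classical all_reals all_analysis.
From mathcomp Require Import complex.
From mathcomp Require Import ring lra.

(** Write [M = A^{1/2} B A^{1/2}].  By a layer-cake decomposition of [f] it is
    enough to treat the spectral projections of [A] onto [[t, +oo)], [t > 0].
    Replacing [A] by [A' = max(A, t)] amounts to a contraction that fixes the
    eigenvectors above [t], and [t B] is obtained from [A'^{1/2} B A'^{1/2}] by
    a contraction that fixes the eigenvectors below [t].  So Hansen's operator
    inequality compares the diagonal entries of the [s]-th powers on both sides
    of the cut, and the unweighted Araki-Lieb-Thirring inequality for [(A', B)]
    does the rest.

    Both inequalities come from one fact, the interpolation of quadratic norms:
    if a linear map is a contraction for two pairs of weighted Euclidean norms,
    then it is one for the geometric means of the weights.  For parallel sums
    of the weights this is a variational triviality, and [x^p] is a positive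
    superposition of [x / (1 + x)] (for [p < 1]) or [x^2 / (1 + x)] (for
    [1 < p < 2], where the inequality is reversed) at all scales.

    Araki-Lieb-Thirring follows by pinching: interpolation bounds
    [tr K C^p K Y^(1-p)] with [K = A^{1/2}], [C = B^s], [p = 1/s], [Y = M^s] by
    its diagonal part in the eigenbasis of [A], and Bernoulli's inequality ends
    the proof for [s >= 1/2].  For [s < 1/2] pinching gives a matrix Young
    inequality that reduces [s] to [s / (1 - s)].

    For [s > 2], [f] is the indicator function of [[1, +oo)] and [A] has
    eigenvalues [1, 1/2, 0], with rational eigenvectors chosen so that an
    eigenvector of [B A], hence of [M], is explicit. *)

Set Implicit Arguments.
Unset Strict Implicit.
Unset Printing Implicit Defensive.

Import Order.TTheory GRing.Theory Num.Theory.
Import numFieldNormedType.Exports.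

Local Open Scope classical_set_scope.
Local Open Scope complex_scope.
Local Open Scope sesquilinear_scope.
Local Open Scope ring_scope.

(** * Bernoulli inequalities for real powers *)

(** Young's inequality for the product of [z ^ p] and 1, with conjugate exponents $1/p$ and
    $1/(1-p)$. *)
Lemma bernoulli_powR_le (R : realType) (p z : R) :
  0 < p < 1 -> 0 <= z -> z `^ p <= 1 + p * (z - 1).
Proof.
move=> /andP[p0 p1] z0.
have q0 : 0 < (1 - p)^-1 by rewrite invr_gt0 subr_gt0.
have p'0 : 0 < p^-1 by rewrite invr_gt0.
have := @conjugate_powR R (z `^ p) 1 p^-1 (1 - p)^-1 (powR_ge0 _ _) ler01 p'0 q0.
rewrite !invrK addrC subrK -powRrM divff ?gt_eqF// powRr1// powR1 => /(_ erefl).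
by rewrite mulr1; lra.
Qed.

(** Young's inequality for the product of [z] and 1, with exponents $p$ and $p/(p-1)$, multiplied by
    [p]. *)
Lemma bernoulli_powR_ge (R : realType) (p z : R) :
  1 < p -> 0 <= z -> 1 + p * (z - 1) <= z `^ p.
Proof.
move=> p1 z0; have p0 : 0 < p by lra.
have q0 : 0 < (1 - p^-1)^-1 by rewrite invr_gt0 subr_gt0 invf_lt1.
have := @conjugate_powR R z 1 p (1 - p^-1)^-1 z0 ler01 p0 q0.
rewrite !invrK addrC subrK powR1 => /(_ erefl).
rewrite -(ler_pM2l p0) mulrDr mulrCA !mulr1 !mul1r mulrBr !divff ?gt_eqF//.
by rewrite mulr1 [p * (_ / _)]mulrC divfK ?gt_eqF//; lra.
Qed.

Lemma le_of_le_mul_gt1 (R : realType) (x y : R) :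
  0 <= y -> (forall r : R, 1 < r -> x <= r * y) -> x <= y.
Proof.
move=> y0 H; apply/ler_addgt0Pr => e e0.
have y10 : 0 < 1 + y by lra.
have r1 : 1 < 1 + e / (1 + y) by rewrite ltrDl divr_gt0.
apply: (le_trans (H _ r1)).
rewrite mulrDl mul1r lerD2l mulrAC ler_pdivrMr//.
by rewrite ler_pM2l//; lra.
Qed.

(** * Powers as superpositions of rational functions *)

Lemma lim_series_le_mul (R : realType) (u v : R^nat) (c : R) :
  cvgn (series u) -> cvgn (series v) -> (forall n, u n <= c * v n) ->
  limn (series u) <= c * limn (series v).
Proof.
move=> cu cv uv.
have ccv : (fun n => c * series v n) @ \oo --> c * limn (series v).
  by apply: cvgMr; exact: cv.
rewrite -(cvg_lim _ ccv)//; apply: ler_lim => //.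
  by apply/cvg_ex; eexists; exact: ccv.
apply: nearW => n; rewrite mulr_sumr; exact: ler_sum.
Qed.

Section ScaleSeries.
Variables (R : realType) (g : R -> R) (p lo hi q : R).
Hypotheses (lop : lo < p) (phi : p < hi) (q1 : 1 < q) (p0 : 0 < p).
Hypotheses (g0 : forall x : R, 0 <= x -> 0 <= g x) (g1 : 0 < g 1).
Hypothesis g_mono : forall x y : R, 0 <= x -> x <= y -> g x <= g y.
Hypotheses (g_lo : forall x : R, 0 < x -> g x <= x `^ lo)
           (g_hi : forall x : R, 0 < x -> g x <= x `^ hi).

Let h y := g y / y `^ p.
Let up x : R^nat := fun k => h (x * q ^+ k).
(** The exponents start at 1, so that the scale [x] itself is counted once, in [up]. *)
Let dn x : R^nat := fun k => h (x / q ^+ k.+1).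

Let q0 : 0 < q. Proof. exact: lt_trans ltr01 q1. Qed.
Let qk0 k : 0 < q ^+ k. Proof. exact: exprn_gt0. Qed.

Let h0 y : 0 < y -> 0 <= h y.
Proof. by move=> y0; rewrite divr_ge0 ?powR_ge0 ?g0 ?ltW. Qed.

Let powR_ratio a e k : 0 < a -> (a * q ^+ k) `^ e = a `^ e * (q `^ e) ^+ k.
Proof.
move=> a0; rewrite powRM ?(ltW a0) ?(ltW (qk0 k))//; congr (_ * _).
rewrite -(powR_mulrn k (ltW q0)) -(powR_mulrn k (powR_ge0 q e)).
exact: powRAC.
Qed.

(** Along the scales $x q^k$ the bound [g_lo] gives $h(y) \le y^{lo-p}$ with a negative exponent,
    hence a geometric majorant. Downwards, [g_hi] and [p < hi] play the same part. *)
Let up_cvg x : 0 < x -> cvgn (series (up x)).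
Proof.
move=> x0.
apply: (@series_le_cvg _ _ (geometric (x `^ (lo - p)) (q `^ (lo - p)))).
- by move=> n; rewrite h0// mulr_gt0.
- by move=> n; rewrite /= mulr_ge0 ?exprn_ge0 ?powR_ge0.
- move=> n /=; have y0 : 0 < x * q ^+ n by rewrite mulr_gt0.
  rewrite -powR_ratio// /up /h ler_pdivrMr ?powR_gt0//.
  rewrite powRB ?(gt_eqF y0) ?implybT// divfK ?gt_eqF ?powR_gt0//.
  exact: g_lo.
- apply: is_cvg_geometric_series.
  rewrite ger0_norm ?powR_ge0// /powR gt_eqF// -expR0 ltr_expR.
  by rewrite nmulr_rlt0 ?subr_lt0// ln_gt0.
Qed.

Let dn_cvg x : 0 < x -> cvgn (series (dn x)).
Proof.
move=> x0; set e := hi - p.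
apply: (@series_le_cvg _ _ (geometric ((x / q) `^ e) (q `^ e)^-1)).
- by move=> n; rewrite h0// divr_gt0.
- by move=> n; rewrite /= mulr_ge0 ?exprn_ge0 ?invr_ge0 ?powR_ge0.
- move=> n /=; have y0 : 0 < x / q ^+ n.+1 by rewrite divr_gt0.
  have -> : (x / q) `^ e * (q `^ e) ^- 1 ^+ n = (x / q ^+ n.+1) `^ e.
    have xq0 : 0 < x / q ^+ n.+1 by [].
    have -> : x / q = x / q ^+ n.+1 * q ^+ n.
      by rewrite exprS; field; rewrite !gt_eqF.
    rewrite powR_ratio// exprVn expr1 -mulrA divff ?mulr1//.
    by rewrite expf_neq0// gt_eqF// powR_gt0.
  rewrite /dn /h ler_pdivrMr ?powR_gt0//.
  rewrite powRB ?(gt_eqF y0) ?implybT// divfK ?gt_eqF ?powR_gt0//.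
  exact: g_hi.
- apply: is_cvg_geometric_series.
  rewrite ger0_norm ?invr_ge0 ?powR_ge0// invf_lt1 ?powR_gt0//.
  rewrite /powR gt_eqF// -expR0 ltr_expR.
  by rewrite mulr_gt0 ?subr_gt0// ln_gt0.
Qed.

(* [H x] is the sum of [h (x * q ^ k)] over all integers [k], so that
   [x `^ p * H x] superposes rescalings of [g] and [H] is [q]-periodic; as [q]
   tends to 1, [H] becomes constant. *)
Let H x := limn (series (up x)) + limn (series (dn x)).

Let lim_series_recl (u : R^nat) : cvgn (series u) ->
  cvgn (series (fun k => u k.+1)) ->
  limn (series u) = u 0%N + limn (series (fun k => u k.+1)).
Proof.
move=> cu cu'; apply/cvg_lim => //.
rewrite -cvg_shiftS.
have -> : [sequence series u n.+1]_n = (fun n => u 0%N + series (fun k => u k.+1) n).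
  by apply/funext => n; rewrite /series /= big_nat_recl.
by apply: cvgD; [exact: cvg_cst|].
Qed.

(** Replacing [x] by [x * q] shifts both series by one place and moves the single term [h x] from
    [up] to [dn]. *)
Let H_scale x : 0 < x -> H (x * q) = H x.
Proof.
move=> x0; have xq0 : 0 < x * q by rewrite mulr_gt0.
have eu : (fun k => up x k.+1) = up (x * q).
  by apply/funext => k; rewrite /up exprS mulrA.
have ed : (fun k => dn (x * q) k.+1) = dn x.
  by apply/funext => k; rewrite /dn !exprS; congr h; field; rewrite !gt_eqF.
have c1 := up_cvg x0; have c2 := up_cvg xq0.
have c3 := dn_cvg x0; have c4 := dn_cvg xq0.
have := lim_series_recl c1; rewrite eu => /(_ c2) E1.
have := lim_series_recl c4; rewrite ed => /(_ c3) E4.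
rewrite /H E1 E4.
have -> : dn (x * q) 0%N = up x 0%N by rewrite /dn /up expr0 expr1 mulr1 mulfK ?gt_eqF.
by rewrite addrCA addrA.
Qed.

Let H1_gt0 : 0 < H 1.
Proof.
have c1 := up_cvg ltr01; have c2 := dn_cvg ltr01.
have u0 : 0 < up 1 0%N by rewrite /up expr0 mulr1 /h powR1 divr1.
apply: ltr_wpDr.
  apply: (limr_ge c2); near=> n; apply: sumr_ge0 => k _.
  by rewrite h0// divr_gt0.
apply: (lt_le_trans u0); apply: (limr_ge c1); exists 1%N => // -[//|n] _.
rewrite /series /= big_nat_recl//= lerDl.
by apply: sumr_ge0 => k _; rewrite h0// mulr_gt0.
Unshelve. all: by end_near. Qed.

(* On one period [x, x q] the factor y^-p varies by at most q^p and g is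
   monotone. *)
Let H_window x y : 0 < x -> x <= y -> y <= x * q -> H x <= q `^ p * H y.
Proof.
move=> x0 xy yq; have y0 : 0 < y by lra.
have hwin c : 0 < c -> h (x * c) <= q `^ p * h (y * c).
  move=> c0; rewrite /h mulrCA.
  have xc0 : 0 < x * c by rewrite mulr_gt0.
  have yc0 : 0 < y * c by rewrite mulr_gt0.
  have xyc : x * c <= y * c by rewrite ler_pM2r.
  apply: ler_pM; rewrite ?invr_ge0 ?powR_ge0 ?g0 ?(ltW xc0)//.
    exact: g_mono (ltW xc0) xyc.
  rewrite -(ler_pM2r (powR_gt0 p yc0)) divfK ?gt_eqF ?powR_gt0// mulrC.
  rewrite ler_pdivrMr ?powR_gt0// -powRM ?(ltW q0) ?(ltW xc0)//.
  apply: ge0_ler_powR; rewrite ?nnegrE ?(ltW p0) ?(ltW yc0) ?mulr_ge0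
    ?(ltW q0) ?(ltW xc0) ?(ltW x0) ?(ltW c0)//.
  by rewrite mulrA ler_pM2r// mulrC.
have c1 := up_cvg x0; have c2 := up_cvg y0.
have c3 := dn_cvg x0; have c4 := dn_cvg y0.
rewrite mulrDr; apply: lerD.
  by apply: lim_series_le_mul c1 c2 _ => n; exact: hwin.
by apply: lim_series_le_mul c3 c4 _ => n; apply: hwin; rewrite invr_gt0.
Qed.

Let H_near n : forall x : R, q ^- n <= x <= q ^+ n ->
  H x <= q `^ p * H 1 /\ H 1 <= q `^ p * H x.
Proof.
have base x' : 1 <= x' <= q -> H x' <= q `^ p * H 1 /\ H 1 <= q `^ p * H x'.
  move=> /andP[x1 xq]; split; last by apply: H_window => //; rewrite mul1r.
  (* By periodicity [H 1] is [H q], so the window estimate applies to $x' \le q$. *)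
  by rewrite -(H_scale ltr01) mul1r; apply: H_window => //; nra.
elim: n => [|n IH] x.
  rewrite !expr0 invr1 => /andP[a b]; by apply: base; rewrite a (le_trans b (ltW q1)).
move=> /andP[xl xh].
have x0 : 0 < x by apply: lt_le_trans xl; rewrite invr_gt0.
have qn1 : 1 <= q ^+ n by apply: exprn_ege1; exact: ltW.
have qn1' : q ^- n <= 1 by rewrite invf_le1.
have [xgt1|xlt1] := leP 1 x.
  have [xq|qx] := leP x q; first by apply: base; rewrite xgt1.
  have xE : x / q * q = x by rewrite divfK// gt_eqF.
  have xq1 : 1 <= x / q by rewrite ler_pdivlMr// mul1r ltW.
  rewrite -xE H_scale ?divr_gt0//; apply: IH.
  by rewrite (le_trans qn1' xq1) ler_pdivrMr// -exprSr.
rewrite -(H_scale x0).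
have [xq|qx] := leP (x * q) 1; last by apply: base; nra.
apply: IH; rewrite -ler_pdivrMr// -invfM -exprSr xl /=.
exact: le_trans qn1.
Qed.

(** Sum the hypothesis over the scales $t = q^k$ with weights $q^{-kp}$: this compares the sums of
    $X^p H(X)$. Replacing $H(X)$ by the constant $H(1)$ costs a factor $q^p$ on each side. *)
Lemma scale_transfer (I J : finType) (w X : J -> R) (w' X' : I -> R) :
  (forall j, 0 <= w j) -> (forall j, 0 <= X j) ->
  (forall i, 0 <= w' i) -> (forall i, 0 <= X' i) -> g 0 = 0 ->
  (forall t : R, 0 < t -> \sum_j w j * g (t * X j) <= \sum_i w' i * g (t * X' i)) ->
  \sum_j w j * X j `^ p <= (q `^ p * q `^ p) * \sum_i w' i * X' i `^ p.
Proof.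
move=> w0 X0 w'0 X'0 gz Hg.
(* Partial sums of $x^p H(x)$, written without division by $x^p$ so that they also make sense, and
   vanish, at $x = 0$. *)
pose S x N := (\sum_(k < N) g (x * q ^+ k) * (q ^+ k) `^ (- p)) +
  \sum_(k < N) g (x / q ^+ k.+1) * (q ^- k.+1) `^ (- p).
have S_term a x c : 0 < a -> 0 < x -> h (x * a) * (c * x `^ p) = c * (g (x * a) * a `^ (-p)).
  move=> a0 x0; rewrite /h powRM ?ltW// powRN; field.
  by rewrite !gt_eqF ?powR_gt0.
have S_sum x N : 0 < x -> S x N = x `^ p * (series (up x) N + series (dn x) N).
  move=> x0; rewrite /S /series /= !big_mkord mulrDr !mulr_sumr.
  congr (_ + _); apply: eq_bigr => k _.
    by rewrite -[LHS]mul1r -S_term// mul1r mulrC.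
  by rewrite -[LHS]mul1r -S_term ?invr_gt0// mul1r mulrC.
have S0 N : S 0 N = 0.
  rewrite /S !big1 ?addr0// => k _; by rewrite mul0r gz mul0r.
have S_cvg x : 0 <= x -> S x @ \oo --> x `^ p * H x.
  rewrite le_eqVlt => /predU1P[<-|x0].
    rewrite powR0 ?gt_eqF// mul0r (_ : S 0 = fun=> 0); first exact: cvg_cst.
    by apply/funext.
  rewrite (_ : S x = fun N => x `^ p * (series (up x) N + series (dn x) N)).
    by apply: cvgMr; apply: cvgD; [exact: up_cvg|exact: dn_cvg].
  by apply/funext => N; exact: S_sum.
have S_le N : \sum_j w j * S (X j) N <= \sum_i w' i * S (X' i) N.
  have E (T : finType) (v Y : T -> R) : \sum_j v j * S (Y j) N =
      \sum_(k < N) (q ^+ k) `^ (- p) * (\sum_j v j * g (q ^+ k * Y j)) +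
      \sum_(k < N) (q ^- k.+1) `^ (- p) * (\sum_j v j * g (q ^- k.+1 * Y j)).
    under eq_bigr do rewrite mulrDr !mulr_sumr.
    rewrite big_split /= exchange_big/= [X in _ + X]exchange_big/=.
    congr (_ + _); apply: eq_bigr => k _; rewrite mulr_sumr;
      by apply: eq_bigr => j _; rewrite [Y j * _]mulrC mulrA [LHS]mulrC.
  rewrite !E; apply: lerD; apply: ler_sum => k _;
    by rewrite ler_wpM2l ?powR_ge0// Hg// ?invr_gt0.
have lim_sum (T : finType) (v Y : T -> R) : (forall j, 0 <= Y j) ->
    (fun N => \sum_j v j * S (Y j) N) @ \oo --> \sum_j v j * (Y j `^ p * H (Y j)).
  move=> Y0; apply: cvg_big => [|j _]; first exact: add_continuous.
  by apply: cvgMr; exact: S_cvg.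
have lim_le : \sum_j w j * (X j `^ p * H (X j)) <= \sum_i w' i * (X' i `^ p * H (X' i)).
  have c1 := lim_sum _ w X X0; have c2 := lim_sum _ w' X' X'0.
  rewrite -(cvg_lim _ c1)// -(cvg_lim _ c2)//; apply: ler_lim.
  - by apply/cvg_ex; eexists; exact: c1.
  - by apply/cvg_ex; eexists; exact: c2.
  - by near=> N; exact: S_le.
have Hb x : 0 < x -> H x <= q `^ p * H 1 /\ H 1 <= q `^ p * H x.
  move=> x0.
  have [n Hn] : exists n, x <= q ^+ n /\ x^-1 <= q ^+ n.
    have bern n : n%:R * (q - 1) <= q ^+ n.
      elim: n => [|n IH]; first by rewrite mul0r.
      have : 1 <= q ^+ n by apply: exprn_ege1; exact: ltW.
      have q1' : 0 <= q - 1 by rewrite subr_ge0 ltW.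
      have -> : q ^+ n.+1 = q ^+ n + q ^+ n * (q - 1).
        by rewrite exprSr mulrBr mulr1 addrC subrK.
      rewrite -addn1 natrD mulrDl mul1r => h1.
      by rewrite lerD// -[leLHS]mul1r ler_wpM2r.
    have m0 : 0 <= Num.max x x^-1 / (q - 1).
      by rewrite divr_ge0 ?subr_ge0 ?(ltW q1)// le_max (ltW x0).
    exists (Num.truncn (Num.max x x^-1 / (q - 1))).+1.
    have := ltW (truncnS_gt (Num.max x x^-1 / (q - 1))).
    rewrite ler_pdivrMr ?subr_gt0// ge_max => /andP[a b].
    by split; apply: le_trans (bern _).
  apply: (@H_near n); case: Hn => -> Hn2; rewrite andbT.
  by rewrite -[x]invrK lef_pV2 ?posrE ?invr_gt0.
have Hq := H1_gt0; clear up_cvg dn_cvg H_scale H1_gt0 H_window H_near S_cvg lim_sum S_sum.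
clearbody H.
have ptw (x : R) : 0 <= x -> x `^ p * H 1 <= q `^ p * (x `^ p * H x) /\
    x `^ p * H x <= q `^ p * (x `^ p * H 1).
  rewrite le_eqVlt => /predU1P[<-|x0].
    by rewrite powR0 ?gt_eqF// !mul0r mulr0.
  have [b1 b2] := Hb _ x0.
  by rewrite !(mulrCA (q `^ p)) !ler_pM2l ?powR_gt0.
rewrite -(ler_pM2r Hq).
apply: (@le_trans _ _ (q `^ p * \sum_j w j * (X j `^ p * H (X j)))).
  rewrite mulr_suml mulr_sumr; apply: ler_sum => j _.
  rewrite -mulrA [_ `^ p * (w j * _)]mulrCA ler_wpM2l//.
  by have [] := ptw _ (X0 j).
apply: (le_trans (ler_wpM2l (powR_ge0 q p) lim_le)).
rewrite -!mulrA ler_wpM2l ?powR_ge0//.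
rewrite mulr_suml mulr_sumr; apply: ler_sum => i _.
rewrite -mulrA [_ `^ p * (w' i * _)]mulrCA ler_wpM2l//.
by have [] := ptw _ (X'0 i).
Unshelve. all: by end_near. Qed.

End ScaleSeries.

(** With $q = r^{1/(2p)}$ the loss $q^p q^p$ is exactly $r$, and $r > 1$ is arbitrary. *)
Lemma powR_transfer (R : realType) (g : R -> R) (p lo hi : R)
    (I J : finType) (w X : J -> R) (w' X' : I -> R) :
  0 < p -> lo < p < hi ->
  (forall x : R, 0 <= x -> 0 <= g x) -> g 0 = 0 -> 0 < g 1 ->
  (forall x y : R, 0 <= x -> x <= y -> g x <= g y) ->
  (forall x : R, 0 < x -> g x <= x `^ lo) -> (forall x : R, 0 < x -> g x <= x `^ hi) ->
  (forall j, 0 <= w j) -> (forall j, 0 <= X j) ->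
  (forall i, 0 <= w' i) -> (forall i, 0 <= X' i) ->
  (forall t : R, 0 < t -> \sum_j w j * g (t * X j) <= \sum_i w' i * g (t * X' i)) ->
  \sum_j w j * X j `^ p <= \sum_i w' i * X' i `^ p.
Proof.
move=> p0 /andP[lop phi] g0 gz g1 gm glo ghi w0 X0 w'0 X'0 Hg.
apply: le_of_le_mul_gt1.
  by apply: sumr_ge0 => i _; rewrite mulr_ge0 ?powR_ge0.
move=> r r1; have r0 : 0 < r := lt_trans ltr01 r1.
have p2 : 0 < (2 * p)^-1 by rewrite invr_gt0 mulr_gt0.
have q1 : 1 < r `^ (2 * p)^-1.
  have e1 : (1 : R) `^ (2 * p)^-1 = 1 by rewrite powR1.
  by rewrite -[ltLHS]e1 gt0_ltr_powR// nnegrE ltW.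
have -> : r = (r `^ (2 * p)^-1) `^ p * (r `^ (2 * p)^-1) `^ p.
  rewrite -powRD; last by rewrite (gt_eqF (powR_gt0 _ r0)) implybT.
  have -> : p + p = 2 * p by ring.
  by rewrite -powRrM mulVf ?powRr1 ?gt_eqF ?mulr_gt0// ltW.
exact: (scale_transfer lop phi q1 p0 g0 g1 gm glo ghi).
Qed.

(** * Squared moduli of complex numbers *)

Section Nsq.
Variable R : realType.
Implicit Types z u v : R[i].

Definition nsq z : R := complex.Re z ^+ 2 + complex.Im z ^+ 2.

Lemma nsqE z : (nsq z)%:C = z * Num.conj z.
Proof. by case: z => a b; rewrite /nsq; simpc; congr Complex; ring. Qed.

Lemma nsqM u v : nsq (u * v) = nsq u * nsq v.
Proof. by case: u v => a b [c d]; rewrite /nsq; simpc => /=; ring. Qed.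

Lemma nsqC (x : R) : nsq x%:C = x ^+ 2.
Proof. by rewrite /nsq /= expr0n addr0. Qed.

Lemma nsqJ z : nsq (Num.conj z) = nsq z.
Proof. by case: z => a b; rewrite /nsq /= sqrrN. Qed.

Lemma nsq_ge0 z : 0 <= nsq z.
Proof. by rewrite addr_ge0 ?sqr_ge0. Qed.

Lemma nsq0 : nsq 0 = 0.
Proof. by rewrite /nsq /= expr0n addr0. Qed.

(* The parallel sum [c y / (c + y)] is the value of a minimisation over
   decompositions of a vector. *)
Lemma nsq_parallel (c y : R) u v : 0 <= c -> 0 < y ->
  c * y / (c + y) * nsq (u + v) <= c * nsq u + y * nsq v.
Proof.
move=> c0 y0; have cy : 0 < c + y by lra.
rewrite mulrAC ler_pdivrMr//.
case: u v => a b [e f]; rewrite /nsq /= -subr_ge0.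
set d := (X in 0 <= X).
have -> : d = (c * a - y * e) ^+ 2 + (c * b - y * f) ^+ 2 by rewrite /d; ring.
by rewrite addr_ge0 ?sqr_ge0.
Qed.

End Nsq.

(** * Transfer from two rational functions to powers *)

Section Transfer.
Variables (R : realType) (I J : finType).
Variables (w X : J -> R) (w' X' : I -> R) (p : R).
Hypotheses (w0 : forall j, 0 <= w j) (X0 : forall j, 0 <= X j).
Hypotheses (w'0 : forall i, 0 <= w' i) (X'0 : forall i, 0 <= X' i).

Lemma powR_transfer_lt1 : 0 < p < 1 ->
  (forall t : R, 0 < t -> \sum_j w j * (t * X j / (1 + t * X j)) <=
                      \sum_i w' i * (t * X' i / (1 + t * X' i))) ->
  \sum_j w j * X j `^ p <= \sum_i w' i * X' i `^ p.
Proof.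
move=> /andP[p0 p1] H.
apply: (@powR_transfer R (fun x => x / (1 + x)) p 0 1) => //.
- by rewrite p0 p1.
- by move=> x x0; rewrite divr_ge0// addr_ge0.
- by rewrite mul0r.
- move=> x y x0 xy; have y0 := le_trans x0 xy.
  rewrite ler_pdivrMr ?ltr_wpDr// mulrAC ler_pdivlMr ?ltr_wpDr//; nra.
- move=> x x0; rewrite powRr0 ler_pdivrMr ?addr_gt0//; lra.
- move=> x x0; rewrite (powRr1 (ltW x0)) ler_pdivrMr ?addr_gt0//; nra.
Qed.

Lemma powR_transfer_gt1 : 1 < p <= 2 ->
  (forall t : R, 0 < t -> \sum_j w j * ((t * X j) ^+ 2 / (1 + t * X j)) <=
                      \sum_i w' i * ((t * X' i) ^+ 2 / (1 + t * X' i))) ->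
  \sum_j w j * X j `^ p <= \sum_i w' i * X' i `^ p.
Proof.
move=> /andP[p1]; rewrite le_eqVlt => /predU1P[->|p2] H.
  (* The growth bound $x^2$ leaves no room above [p = 2]. Instead $t$ is taken small:
     $(tx)^2/(1+tx)$ divided by $t^2$ lies between $x^2 - t x^3$ and $x^2$, and the third moment [c]
     tells how small. *)
  under eq_bigr do rewrite powR_mulrn//.
  under [leRHS]eq_bigr do rewrite powR_mulrn//.
  apply/ler_addgt0Pr => e e0.
  set c := \sum_j w j * X j ^+ 3.
  have c0 : 0 <= c by apply: sumr_ge0 => j _; rewrite mulr_ge0 ?exprn_ge0.
  set t := e / (1 + c); have c1 : 0 < 1 + c by rewrite ltr_wpDr.
  have t0 : 0 < t by rewrite divr_gt0.
  have lb : \sum_j w j * X j ^+ 2 - t * c <=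
      \sum_j w j * ((t * X j) ^+ 2 / (1 + t * X j)) / t ^+ 2.
    rewrite mulr_sumr -sumrB; apply: ler_sum => j _.
    rewrite [t * (w j * _)]mulrCA -mulrBr -mulrA ler_wpM2l//.
    have Xj := X0 j; have tX : 0 <= t * X j by rewrite mulr_ge0 ?(ltW t0).
    rewrite ler_pdivlMr ?exprn_gt0// ler_pdivlMr ?ltr_wpDr//.
    have -> : (X j ^+ 2 - t * X j ^+ 3) * t ^+ 2 * (1 + t * X j) =
              (t * X j) ^+ 2 * (1 - (t * X j) ^+ 2) by ring.
    by rewrite ler_piMr ?sqr_ge0// gerBl sqr_ge0.
  have ub : \sum_i w' i * ((t * X' i) ^+ 2 / (1 + t * X' i)) / t ^+ 2 <=
      \sum_i w' i * X' i ^+ 2.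
    apply: ler_sum => i _.
    rewrite -mulrA ler_wpM2l// ler_pdivrMr ?exprn_gt0//.
    have tX : 0 <= t * X' i by rewrite mulr_ge0 ?(ltW t0).
    rewrite ler_pdivrMr ?ltr_wpDr// -exprMn [X' i * t]mulrC.
    by rewrite ler_peMr ?sqr_ge0// lerDl.
  have tc : t * c <= e by rewrite /t mulrAC ler_pdivrMr//; nra.
  have mid : \sum_j w j * ((t * X j) ^+ 2 / (1 + t * X j)) / t ^+ 2 <=
     \sum_i w' i * ((t * X' i) ^+ 2 / (1 + t * X' i)) / t ^+ 2.
    by rewrite -!mulr_suml ler_pM2r ?invr_gt0 ?exprn_gt0// H.
  by lra.
apply: (@powR_transfer R (fun x => x ^+ 2 / (1 + x)) p 1 2) => //.
- by rewrite (lt_trans ltr01 p1).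
- by rewrite p1 p2.
- by move=> x x0; rewrite divr_ge0 ?sqr_ge0// addr_ge0.
- by rewrite expr0n mul0r.
- move=> x y x0 xy; have y0 := le_trans x0 xy.
  rewrite ler_pdivrMr ?ltr_wpDr// mulrAC ler_pdivlMr ?ltr_wpDr//.
  have h1 : x ^+ 2 <= y ^+ 2 by nra.
  have h2 : x * (x * y) <= y * (x * y) by rewrite ler_wpM2r ?mulr_ge0.
  by nra.
- move=> x x0; rewrite (powRr1 (ltW x0)) ler_pdivrMr ?addr_gt0//; nra.
- move=> x x0; rewrite (powR_mulrn _ (ltW x0)) ler_pdivrMr ?addr_gt0//.
  by rewrite ler_peMr ?sqr_ge0// lerDl ltW.
Qed.

End Transfer.

(** * Interpolation of quadratic norms *)

Section QuadraticInterpolation.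
Variables (R : realType) (I J : finType) (T : J -> I -> R[i]).
Variables (a m : J -> R) (b n : I -> R) (p : R).
Hypotheses (a0 : forall j, 0 < a j) (m0 : forall j, 0 <= m j).
Hypotheses (b0 : forall i, 0 < b i) (n0 : forall i, 0 <= n i).
Let S (x : I -> R[i]) j := \sum_i T j i * x i.
Hypothesis ab : forall x, \sum_j a j * nsq (S x j) <= \sum_i b i * nsq (x i).

(** Split [x] into [y + z] at the minimiser of $t n_i |y_i|^2 + b_i |z_i|^2$. The [m]-[n] bound is
    applied to [y], the [a]-[b] bound to [z], and [nsq_parallel] recombines the two images. *)
Let parallel_le (x : I -> R[i]) t : 0 < t ->
  (forall y, \sum_j m j * nsq (S y j) <= \sum_i n i * nsq (y i)) ->
  \sum_j a j * nsq (S x j) * (t * (m j / a j) / (1 + t * (m j / a j))) <=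
  \sum_i b i * nsq (x i) * (t * (n i / b i) / (1 + t * (n i / b i))).
Proof.
move=> t0 mn.
pose r i := b i / (b i + t * n i); pose r' i := t * n i / (b i + t * n i).
have bn i : 0 < b i + t * n i by rewrite ltr_wpDr// mulr_ge0// (ltW t0).
pose y i := (r i)%:C * x i; pose z i := (r' i)%:C * x i.
have xE j : S x j = S y j + S z j.
  rewrite -big_split /=; apply: eq_bigr => i _.
  rewrite /y /z -mulrDr -mulrDl -rmorphD /= /r /r' -mulrDl divff ?gt_eqF//.
  by rewrite mul1r.
apply: (@le_trans _ _ (\sum_j (t * (m j * nsq (S y j)) + a j * nsq (S z j)))).
  apply: ler_sum => j _; rewrite xE.
  have tm0 : 0 <= t * m j by rewrite mulr_ge0 ?(ltW t0).
  have ma0 : 0 < t * m j + a j by rewrite ltr_wpDl.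
  rewrite [leRHS](_ : _ = t * m j * nsq (S y j) + a j * nsq (S z j)) ?mulrA//.
  apply: le_trans (nsq_parallel (S y j) (S z j) tm0 (a0 j)).
  rewrite le_eqVlt; apply/orP; left; apply/eqP; field.
  by rewrite !gt_eqF//= addrC.
rewrite big_split /= -mulr_sumr.
apply: (le_trans (lerD (ler_wpM2l (ltW t0) (mn y)) (ab z))).
rewrite mulr_sumr -big_split /= le_eqVlt; apply/orP; left; apply/eqP.
apply: eq_bigr => i _; rewrite /y /z !nsqM !nsqC /r /r'.
by field; rewrite !gt_eqF// addrC.
Qed.

(** The weight [a j * (m j / a j) ^ p] is the geometric mean $a_j^{1-p} m_j^p$, a superposition of
    the parallel sums of $a_j$ and $t m_j$. *)
Lemma quadratic_interpolation_le x : 0 < p < 1 ->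
  (forall y, \sum_j m j * nsq (S y j) <= \sum_i n i * nsq (y i)) ->
  \sum_j a j * (m j / a j) `^ p * nsq (S x j) <=
  \sum_i b i * (n i / b i) `^ p * nsq (x i).
Proof.
move=> p01 mn.
under eq_bigr do rewrite mulrAC; under [leRHS]eq_bigr do rewrite mulrAC.
apply: powR_transfer_lt1 => //.
- by move=> j; rewrite mulr_ge0 ?nsq_ge0 ?(ltW (a0 j)).
- by move=> j; rewrite divr_ge0 ?(ltW (a0 j)).
- by move=> i; rewrite mulr_ge0 ?nsq_ge0 ?(ltW (b0 i)).
- by move=> i; rewrite divr_ge0 ?(ltW (b0 i)).
- by move=> t t0; exact: parallel_le.
Qed.

(** Since $y^2/(1+y) = y - y/(1+y)$, the parallel-sum inequality is reversed as soon as the linear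
    terms cancel, which is why the [m]-[n] relation is an equality. *)
Lemma quadratic_interpolation_ge x : 1 < p <= 2 ->
  (forall y, \sum_j m j * nsq (S y j) = \sum_i n i * nsq (y i)) ->
  \sum_i b i * (n i / b i) `^ p * nsq (x i) <=
  \sum_j a j * (m j / a j) `^ p * nsq (S x j).
Proof.
move=> p12 mn.
under eq_bigr do rewrite mulrAC; under [leRHS]eq_bigr do rewrite mulrAC.
apply: powR_transfer_gt1 => //.
- by move=> i; rewrite mulr_ge0 ?nsq_ge0 ?(ltW (b0 i)).
- by move=> i; rewrite divr_ge0 ?(ltW (b0 i)).
- by move=> j; rewrite mulr_ge0 ?nsq_ge0 ?(ltW (a0 j)).
- by move=> j; rewrite divr_ge0 ?(ltW (a0 j)).
move=> t t0.
have sqE (c u v s : R) : 0 < c -> 0 <= u -> c * s * ((t * (u / c)) ^+ 2 / (1 + t * (u / c))) =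
    t * (u * s) - c * s * (t * (u / c) / (1 + t * (u / c))).
  move=> c0 u0; field; rewrite !gt_eqF// ltr_wpDr// mulr_ge0// (ltW t0).
  by [].
under eq_bigr do rewrite sqE//; under [leRHS]eq_bigr do rewrite sqE//.
rewrite !sumrB -!mulr_sumr mn lerD2l lerN2; apply: parallel_le => // y.
by rewrite mn.
Qed.

End QuadraticInterpolation.

(** * Pinching *)

Lemma le_of_le_add_mulrn (R : realType) (x y c : R) (n : nat) : 0 <= c ->
  (forall e : R, 0 < e -> x <= y + c * (e *+ n)) -> x <= y.
Proof.
move=> c0 H; apply/ler_addgt0Pr => e e0.
have k0 : 0 < 1 + c *+ n by rewrite ltr_wpDr ?mulrn_wge0.
apply: (le_trans (H _ (divr_gt0 e0 k0))); rewrite lerD2l.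
rewrite mulrnAr -mulrnAl mulrA ler_pdivrMr// mulrC ler_wpM2l ?(ltW e0)//.
by rewrite lerDr.
Qed.

Lemma unitarymx_adjK (C : numClosedFieldType) (n : nat) (U : 'M[C]_n) :
  U \is unitarymx -> U^t* *m U = 1%:M.
Proof. by rewrite -trmxC_unitary => /unitarymxP; rewrite trmxCK. Qed.

Section Pinching.
Variables (R : realType) (n : nat).
Implicit Types (U V : 'M[R[i]]_n).

Lemma nsq_sumE (x : 'cV[R[i]]_n) :
  (x^t* *m x) 0 0 = (\sum_i nsq (x i 0))%:C.
Proof.
rewrite mxE rmorph_sum /=; apply: eq_bigr => i _.
by rewrite !mxE nsqE mulrC.
Qed.

Lemma parseval U (x : 'I_n -> R[i]) : U \is unitarymx ->
  \sum_i nsq (\sum_j U i j * x j) = \sum_j nsq (x j).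
Proof.
move=> Uu; apply: (@complexI R).
pose v : 'cV[R[i]]_n := \col_j x j.
transitivity ((v^t* *m v) 0 0); last first.
  by rewrite nsq_sumE; congr (_%:C); apply: eq_bigr => j _; rewrite mxE.
transitivity (((U *m v)^t* *m (U *m v)) 0 0); last first.
  by rewrite trmx_mul map_mxM /= -mulmxA (mulmxA _ U) unitarymx_adjK// mul1mx.
rewrite nsq_sumE; congr (_%:C); apply: eq_bigr => i _; congr nsq.
by rewrite mxE; apply: eq_bigr => j _; rewrite mxE.
Qed.

Lemma unitary_row_nsq U i : U \is unitarymx -> \sum_j nsq (U i j) = 1.
Proof.
move=> /unitarymxP/matrixP/(_ i i); rewrite !mxE eqxx => H.
apply: (@complexI R); rewrite rmorph1 -[RHS]H rmorph_sum; apply: eq_bigr => j _.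
by rewrite !mxE /= nsqE.
Qed.

Lemma unitary_col_nsq U j : U \is unitarymx -> \sum_i nsq (U i j) = 1.
Proof.
rewrite -trmx_unitary => /(unitary_row_nsq j) <-.
by apply: eq_bigr => i _; rewrite mxE.
Qed.

Lemma weighted_row_gt0 U (a : 'I_n -> R) j : U \is unitarymx ->
  (forall l, 0 < a l) -> 0 < \sum_l a l * nsq (U j l).
Proof.
move=> Uu a0.
have a_ge l : 0 <= a l * nsq (U j l) by rewrite mulr_ge0 ?nsq_ge0 ?(ltW (a0 l)).
rewrite lt0r sumr_ge0 ?andbT//; apply/negP => /eqP/psumr_eq0P H.
have : \sum_l nsq (U j l) = 0.
  rewrite big1// => l _; have /eqP := H (fun l _ => a_ge l) l isT.
  by rewrite mulf_eq0 gt_eqF//= => /eqP.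
by rewrite unitary_row_nsq// => /eqP; rewrite oner_eq0.
Qed.

Section Inequalities.
Variables (U V : 'M[R[i]]_n) (a c : 'I_n -> R) (p : R).
Hypotheses (Uu : U \is unitarymx) (Vu : V \is unitarymx).
Hypotheses (a0 : forall l, 0 < a l) (c0 : forall i, 0 <= c i).
(** Here [b] and [d] are the diagonals of [V diag(a) V^t*] and of [U^t* diag(c) U]. *)
Let b j := \sum_l a l * nsq (V j l).
Let d j := \sum_i c i * nsq (U i j).

Let b0 j : 0 < b j.
Proof. exact: weighted_row_gt0 Vu a0. Qed.

Let d0 j : 0 <= d j.
Proof. by rewrite sumr_ge0// => i _; rewrite mulr_ge0 ?nsq_ge0. Qed.

(** The linear map sending a diagonal [x] to the entries of [U diag(x) V]. *)
Let T (k : 'I_n * 'I_n) j := U k.1 j * V j k.2.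

(** Summing over the row index against the unitary [U] removes the cross terms in [j], so the
    weighted norm of [T y] becomes diagonal. In [sum_c] the unitary [V] does this for the column
    index. *)
Let sum_a (y : 'I_n -> R[i]) :
  \sum_k a k.2 * nsq (\sum_j T k j * y j) = \sum_j b j * nsq (y j).
Proof.
rewrite -(pair_bigA _ (fun i l => a l * nsq (\sum_j T (i, l) j * y j))) /=.
rewrite exchange_big /=.
under [RHS]eq_bigr do rewrite mulr_suml.
rewrite [RHS]exchange_big /=; apply: eq_bigr => l _; rewrite -mulr_sumr.
have -> : \sum_i nsq (\sum_j T (i, l) j * y j) =
          \sum_i nsq (\sum_j U i j * (V j l * y j)).
  by apply: eq_bigr => i _; congr nsq; apply: eq_bigr => j _; rewrite mulrA.
rewrite parseval// mulr_sumr; apply: eq_bigr => j _.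
by rewrite nsqM mulrA.
Qed.

Let sum_c (y : 'I_n -> R[i]) :
  \sum_k c k.1 * nsq (\sum_j T k j * y j) = \sum_j d j * nsq (y j).
Proof.
rewrite -(pair_bigA _ (fun i l => c i * nsq (\sum_j T (i, l) j * y j))) /=.
under [RHS]eq_bigr do rewrite mulr_suml.
rewrite [RHS]exchange_big /=; apply: eq_bigr => i _; rewrite -mulr_sumr.
have -> : \sum_l nsq (\sum_j T (i, l) j * y j) =
          \sum_l nsq (\sum_j V^T l j * (U i j * y j)).
  apply: eq_bigr => l _; congr nsq; apply: eq_bigr => j _.
  by rewrite mxE /T /=; ring.
rewrite parseval ?trmx_unitary// mulr_sumr; apply: eq_bigr => j _.
by rewrite nsqM mulrA.
Qed.

(** With [C = U^t* diag(c) U], [Y = V diag(a) V^t*] and [K = diag(x)], the left side is the trace of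
    $K^* C^p K Y^{1-p}$; on the right [C] and [Y] are replaced by their diagonal parts. *)
Lemma pinching_le (x : 'I_n -> R[i]) : 0 < p < 1 ->
  \sum_i \sum_l a l * (c i / a l) `^ p * nsq (\sum_j U i j * x j * V j l) <=
  \sum_j b j * (d j / b j) `^ p * nsq (x j).
Proof.
move=> p01.
have := @quadratic_interpolation_le R _ _ T (fun k => a k.2) (fun k => c k.1)
  b d p (fun k => a0 _) (fun k => c0 _) b0 d0 _ x p01 _.
rewrite -(pair_bigA _ (fun i l => a l * (c i / a l) `^ p * nsq (\sum_j T (i, l) j * x j))) /=.
have E i l : \sum_j T (i, l) j * x j = \sum_j U i j * x j * V j l.
  by apply: eq_bigr => j _; rewrite /T mulrAC.
under eq_bigr do under eq_bigr do rewrite E.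
by apply=> y; rewrite ?sum_a ?sum_c.
Qed.

Lemma pinching_ge (x : 'I_n -> R[i]) : 1 < p <= 2 ->
  \sum_j b j * (d j / b j) `^ p * nsq (x j) <=
  \sum_i \sum_l a l * (c i / a l) `^ p * nsq (\sum_j U i j * x j * V j l).
Proof.
move=> p12.
have := @quadratic_interpolation_ge R _ _ T (fun k => a k.2) (fun k => c k.1)
  b d p (fun k => a0 _) (fun k => c0 _) b0 d0 _ x p12 _.
rewrite -(pair_bigA _ (fun i l => a l * (c i / a l) `^ p * nsq (\sum_j T (i, l) j * x j))) /=.
have E i l : \sum_j T (i, l) j * x j = \sum_j U i j * x j * V j l.
  by apply: eq_bigr => j _; rewrite /T mulrAC.
under [leRHS]eq_bigr do under eq_bigr do rewrite E.
by apply=> y; rewrite ?sum_a ?sum_c.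
Qed.

End Inequalities.

(** * Araki-Lieb-Thirring for exponents at least 1/2, by pinching *)

Section ArakiLiebThirring.
Variables (U V : 'M[R[i]]_n) (a b : 'I_n -> R) (s : R).
Hypotheses (Uu : U \is unitarymx) (Vu : V \is unitarymx) (s0 : 0 < s).
Hypotheses (a0 : forall l, 0 <= a l) (b0 : forall i, 0 <= b i).

(** The diagonal entries of [M] in the basis formed by the columns of [V]; they are its eigenvalues
    once [V] diagonalises it. *)
Let m l := \sum_i b i * nsq (\sum_j U i j * (Num.sqrt (a j))%:C * V j l).
Let m0 l : 0 <= m l.
Proof. by rewrite sumr_ge0// => i _; rewrite mulr_ge0 ?nsq_ge0. Qed.

Section Perturbed.
Variable e : R.
Hypothesis e0 : 0 < e.

(* The eigenvalues of [M^s], made positive on the kernel of [M] because the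
   pinching uses the powers [1 - p] of them, which may be negative. *)
Let y l := if m l == 0 then e else m l `^ s.
Let y0 l : 0 < y l.
Proof.
rewrite /y; case: eqVneq => // ml; apply: powR_gt0; by rewrite lt0r ml m0.
Qed.

Let p := s^-1.
Let B j := \sum_l y l * nsq (V j l).
Let D j := \sum_i b i `^ s * nsq (U i j).

(** As $C^p = B$, the pinched trace is $\sum y_l^{1-p} m_l$, and $m_l^{s(1-p)} m_l = m_l^s$. On the
    kernel the factor $m_l = 0$ hides the perturbation. *)
Let sumE : \sum_i \sum_l y l * (b i `^ s / y l) `^ p *
  nsq (\sum_j U i j * (Num.sqrt (a j))%:C * V j l) = \sum_l m l `^ s.
Proof.
rewrite exchange_big /=; apply: eq_bigr => l _.
transitivity (\sum_i y l / y l `^ p *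
    (b i * nsq (\sum_j U i j * (Num.sqrt (a j))%:C * V j l))).
  apply: eq_bigr => i _; rewrite mulrA; congr (_ * _).
  rewrite powRM ?powR_ge0 ?invr_ge0 ?(ltW (y0 l))//.
  rewrite -powRrM /p divff ?gt_eqF// powRr1//.
  have -> : (y l)^-1 `^ s^-1 = (y l `^ s^-1)^-1.
    by rewrite -powR_inv1 ?(ltW (y0 l))// powRAC powR_inv1 ?powR_ge0.
  ring.
rewrite -mulr_sumr -/(m l) /y; case: eqVneq => [->|ml].
  by rewrite mulr0 powR0 ?gt_eqF.
rewrite -powRrM divff ?gt_eqF// powRr1// -mulrA mulVf ?mulr1//.
Qed.

Let sumB : \sum_j B j <= \sum_l m l `^ s + e *+ n /\ \sum_l m l `^ s <= \sum_j B j.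
Proof.
have -> : \sum_j B j = \sum_l y l.
  rewrite exchange_big /=; apply: eq_bigr => l _.
  by rewrite -mulr_sumr unitary_col_nsq// mulr1.
split.
  have -> : e *+ n = \sum_(l < n) e by rewrite sumr_const card_ord.
  rewrite -big_split /=; apply: ler_sum => l _; rewrite /y.
  by case: eqP => _; rewrite ?lerDr ?lerDl ?powR_ge0 ?(ltW e0).
apply: ler_sum => l _; rewrite /y; case: eqP => // ->.
by rewrite powR0 ?gt_eqF// ltW.
Qed.

Let sumD : \sum_j D j * a j `^ s = \sum_i \sum_j b i `^ s * a j `^ s * nsq (U i j).
Proof.
rewrite exchange_big /=; apply: eq_bigr => j _; rewrite mulr_suml.
by apply: eq_bigr => i _; rewrite mulrAC.
Qed.

(** Writing $a_j = (a_j^s)^p$ moves the weight inside the power, where Bernoulli can reach it. *)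
Let termE j : 0 < B j ->
  B j * (D j / B j) `^ p * nsq (Num.sqrt (a j))%:C = B j * (D j * a j `^ s / B j) `^ p.
Proof.
move=> Bj; rewrite nsqC sqr_sqrtr// -mulrA; congr (_ * _).
have Dj : 0 <= D j by rewrite sumr_ge0// => i _; rewrite mulr_ge0 ?nsq_ge0 ?powR_ge0.
rewrite [in RHS]mulrAC [in RHS]powRM ?powR_ge0// ?divr_ge0 ?(ltW Bj)//.
by rewrite -powRrM /p divff ?gt_eqF// powRr1.
Qed.

Let B0 j : 0 < B j.
Proof. exact: weighted_row_gt0 Vu y0. Qed.

Let z0 j : 0 <= D j * a j `^ s / B j.
Proof.
rewrite !mulr_ge0 ?powR_ge0 ?invr_ge0 ?(ltW (B0 j))//.
by rewrite sumr_ge0// => i _; rewrite mulr_ge0 ?nsq_ge0 ?powR_ge0.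
Qed.

(** Pinching and Bernoulli give $t \le (1-p)(t+E) + pQ$ for $t = \sum m_l^s$, $E = ne$ and $Q$ the
    trace of the product of powers. Solve for $t$ with $sp = 1$. *)
Lemma alt_perturbed_gt1 : 1 < s ->
  \sum_l m l `^ s <=
  \sum_i \sum_j b i `^ s * a j `^ s * nsq (U i j) + s * (e *+ n).
Proof.
move=> s1; have p01 : 0 < p < 1 by rewrite invr_gt0 s0 invf_lt1.
have := pinching_le Uu Vu y0 (fun i => powR_ge0 (b i) s) (fun j => (Num.sqrt (a j))%:C) p01.
rewrite sumE -sumD.
under [leRHS]eq_bigr do rewrite termE//.
set t := \sum_l m l `^ s => h1.
have h2 : \sum_j B j * (D j * a j `^ s / B j) `^ p <=
    (1 - p) * \sum_j B j + p * \sum_j D j * a j `^ s.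
  rewrite !mulr_sumr -big_split /=; apply: ler_sum => j _.
  apply: (le_trans (ler_wpM2l (ltW (B0 j)) (bernoulli_powR_le p01 (z0 j)))).
  rewrite le_eqVlt; apply/orP; left; apply/eqP; field.
  by rewrite gt_eqF.
have [h3 _] := sumB; rewrite -/t in h3.
have sp : s * p = 1 by rewrite divff ?gt_eqF.
have /andP[p0 p1] := p01.
have en : 0 <= e *+ n by rewrite mulrn_wge0 ?ltW.
set E := e *+ n in en h3 *; set Q := \sum_j D j * a j `^ s in h2 *.
have h4 : (1 - p) * \sum_j B j <= (1 - p) * (t + E) by rewrite ler_wpM2l// subr_ge0 ltW.
have h5 : p * t <= p * Q + E by nra.
have := ler_wpM2l (ltW s0) h5; rewrite mulrDr !mulrA sp !mul1r.
by [].
Qed.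

(** Now $1 < p \le 2$, so pinching and Bernoulli are both reversed. As $1 - p < 0$, it is still the
    upper bound on the sum of [B] that enters. *)
Lemma alt_perturbed_lt1 : 2^-1 <= s < 1 ->
  \sum_i \sum_j b i `^ s * a j `^ s * nsq (U i j) <=
  \sum_l m l `^ s + e *+ n.
Proof.
move=> /andP[s2 s1]; have p12 : 1 < p <= 2.
  by rewrite invf_gt1// s1 /= invf_ple ?posrE.
have := pinching_ge Uu Vu y0 (fun i => powR_ge0 (b i) s) (fun j => (Num.sqrt (a j))%:C) p12.
rewrite sumE -sumD.
under [leLHS]eq_bigr do rewrite termE//.
set t := \sum_l m l `^ s => h1.
have /andP[p1 p2] := p12.
have h2 : (1 - p) * \sum_j B j + p * \sum_j D j * a j `^ s <=
    \sum_j B j * (D j * a j `^ s / B j) `^ p.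
  rewrite !mulr_sumr -big_split /=; apply: ler_sum => j _.
  apply: le_trans (ler_wpM2l (ltW (B0 j)) (bernoulli_powR_ge p1 (z0 j))).
  rewrite le_eqVlt; apply/orP; left; apply/eqP; field.
  by rewrite gt_eqF.
have [h3 _] := sumB; rewrite -/t in h3.
have en : 0 <= e *+ n by rewrite mulrn_wge0 ?ltW.
set E := e *+ n in en h3 *; set Q := \sum_j D j * a j `^ s in h2 *.
set BB := \sum_j B j in h2 h3.
have h4 : p * Q <= p * (t + E) by nra.
by rewrite ler_pM2l in h4 => //; lra.
Qed.

End Perturbed.

Lemma alt_gt1 : 1 < s ->
  \sum_l m l `^ s <= \sum_i \sum_j b i `^ s * a j `^ s * nsq (U i j).
Proof.
move=> s1; apply: (le_of_le_add_mulrn (ltW s0)) => e e0.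
exact: alt_perturbed_gt1.
Qed.

Lemma alt_lt1 : 2^-1 <= s < 1 ->
  \sum_i \sum_j b i `^ s * a j `^ s * nsq (U i j) <= \sum_l m l `^ s.
Proof.
move=> s1; apply: (@le_of_le_add_mulrn R _ _ 1 n ler01) => e e0.
by rewrite mul1r; exact: alt_perturbed_lt1.
Qed.

End ArakiLiebThirring.
End Pinching.

(** * Unitary diagonalisation *)

Section UnitaryDiagonal.
Variables (C : numClosedFieldType) (n : nat).
Implicit Types (U V W : 'M[C]_n) (d e : 'rV[C]_n).

Lemma adjmxM m k l (A : 'M[C]_(m, k)) (B : 'M[C]_(k, l)) :
  (A *m B)^t* = B^t* *m A^t*.
Proof. by rewrite trmx_mul map_mxM. Qed.

Definition cdiag U d : 'M[C]_n := U^t* *m diag_mx d *m U.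

Lemma cdiagM U d e : U \is unitarymx ->
  cdiag U d *m cdiag U e = cdiag U (\row_i (d 0 i * e 0 i)).
Proof.
move=> /unitarymxP UU; rewrite /cdiag -mulmx_diag !mulmxA.
by rewrite -(mulmxA _ U) UU mulmx1.
Qed.

Lemma cdiag_adj U d : (forall i, Num.conj (d 0 i) = d 0 i) ->
  (cdiag U d)^t* = cdiag U d.
Proof.
move=> dr; rewrite !adjmxM trmxCK mulmxA; congr (_ *m _ *m _).
apply/matrixP => i j; rewrite !mxE eq_sym; case: eqVneq => [->|_].
  by rewrite !mulr1n dr.
by rewrite !mulr0n rmorph0.
Qed.

Lemma cdiagZ U d (t : C) : t *: cdiag U d = cdiag U (t *: d).
Proof. by rewrite /cdiag linearZ /= -scalemxAr -scalemxAl. Qed.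

Lemma cdiag1 U : U \is unitarymx -> cdiag U (const_mx 1) = 1%:M.
Proof. by move=> Uu; rewrite /cdiag diag_const_mx mulmx1 unitarymx_adjK. Qed.

Lemma unitary_mulC U V : U \is unitarymx -> V \is unitarymx ->
  U *m V^t* \is unitarymx.
Proof. by move=> Uu Vu; rewrite mul_unitarymx ?trmxC_unitary. Qed.

Lemma mulC_conj U V i j : (V *m U^t*) j i = Num.conj ((U *m V^t*) i j).
Proof.
have := congr1 (fun X : 'M[C]_n => X j i) (adjmxM U (V^t*)).
by rewrite trmxCK mxE mxE => <-.
Qed.

Lemma quadform_cdiag U d (x : 'cV[C]_n) :
  (x^t* *m cdiag U d *m x) 0 0 =
  \sum_i d 0 i * ((U *m x) i 0 * Num.conj ((U *m x) i 0)).
Proof.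
have -> : x^t* *m cdiag U d *m x = (U *m x)^t* *m (diag_mx d *m (U *m x)).
  by rewrite /cdiag adjmxM !mulmxA.
move: (U *m x) => y; rewrite mxE; apply: eq_bigr => i _.
by rewrite mul_diag_mx !mxE mulrC mulrA.
Qed.

Lemma mxtrace_cdiag U V d e :
  \tr (cdiag U d *m cdiag V e) =
  \sum_i \sum_l d 0 i * (e 0 l * ((V *m U^t*) l i * Num.conj ((V *m U^t*) l i))).
Proof.
have -> : \tr (cdiag U d *m cdiag V e) =
    \tr (diag_mx d *m ((V *m U^t*)^t* *m (diag_mx e *m (V *m U^t*)))).
  by rewrite /cdiag -!mulmxA mxtrace_mulC adjmxM trmxCK !mulmxA.
move: (V *m U^t*) => Q; apply: eq_bigr => i _.
rewrite mul_diag_mx mxE mxE mulr_sumr; apply: eq_bigr => l _.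
by rewrite mul_diag_mx !mxE; ring.
Qed.

(* The unitary change of basis between two diagonalisations vanishes off the
   pairs of equal eigenvalues, so applying a function to the eigenvalues does
   not depend on the diagonalisation. *)
Lemma cdiag_map (S U : 'M[C]_n) d e (f : C -> C) :
  S \is unitarymx -> U \is unitarymx -> cdiag S d = cdiag U e ->
  cdiag S (map_mx f d) = cdiag U (map_mx f e).
Proof.
move=> Su Uu AE; pose Q := S *m U^t*.
have E : diag_mx d *m Q = Q *m diag_mx e.
  have -> : diag_mx d = S *m cdiag S d *m S^t*.
    by rewrite !mulmxA (unitarymxP Su) mul1mx -mulmxA (unitarymxP Su) mulmx1.
  rewrite AE /Q /cdiag !mulmxA -(mulmxA _ (S^t*)) unitarymx_adjK// mulmx1.
  by rewrite -(mulmxA _ U) (unitarymxP Uu) mulmx1.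
have E2 : diag_mx (map_mx f d) *m Q = Q *m diag_mx (map_mx f e).
  move: (Q) E => Q' {}E; apply/matrixP => i j; have /matrixP/(_ i j) := E.
  rewrite !mul_diag_mx !mul_mx_diag !mxE => Eij.
  have [->|Qn] := eqVneq (Q' i j) 0; first by rewrite mulr0 mul0r.
  have -> : d 0 i = e 0 j by apply: (mulIf Qn); rewrite Eij mulrC.
  by rewrite mulrC.
rewrite /cdiag -[LHS]mulmx1 -(unitarymx_adjK Uu) !mulmxA -(mulmxA _ S) -/Q.
by rewrite -(mulmxA _ (diag_mx _)) E2 /Q !mulmxA unitarymx_adjK// mul1mx.
Qed.

Lemma hermitian_cdiag (A : 'M[C]_n) : A^t* = A ->
  A = cdiag (spectralmx A) (spectral_diag A) /\
  forall i, spectral_diag A 0 i \is Num.real.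
Proof.
move=> AA; have Ah : A \is hermsymmx.
  by apply/is_hermitianmxP; rewrite expr0 scale1r AA.
split.
  rewrite {1}(orthomx_spectralP (hermitian_normalmx Ah)) /cdiag.
  by rewrite invmx_unitary ?spectral_unitarymx.
by move=> i; have /mxOverP/(_ 0 i) := hermitian_spectral_diag_real Ah.
Qed.

Lemma hermsymmxE (A : 'M[C]_n) : A \is hermsymmx <-> A^t* = A.
Proof.
split; first by move/is_hermitianmxP; rewrite expr0 scale1r => {2}->.
by move=> AA; apply/is_hermitianmxP; rewrite expr0 scale1r AA.
Qed.

Lemma cdiag_conj_entry V d l (x := V^t* *m delta_mx l 0 : 'cV[C]_n) :
  V \is unitarymx -> (x^t* *m cdiag V d *m x) 0 0 = d 0 l.
Proof.
move=> Vu; rewrite quadform_cdiag mulmxA (unitarymxP Vu) mul1mx (bigD1 l)//=.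
rewrite big1 ?addr0 => [|j jl]; first by rewrite !mxE !eqxx /= mul1r conjC1 mulr1.
by rewrite !mxE (negbTE jl) mul0r mulr0.
Qed.

Lemma cdiag_spectral (A : 'M[C]_n) d :
  invmx (spectralmx A) *m diag_mx d *m spectralmx A = cdiag (spectralmx A) d.
Proof. by rewrite invmx_unitary ?spectral_unitarymx. Qed.

Lemma quadform_conj (H N : 'M[C]_n) (x : 'cV[C]_n) : H^t* = H ->
  x^t* *m (H *m N *m H) *m x = (H *m x)^t* *m N *m (H *m x).
Proof. by move=> HH; rewrite adjmxM HH !mulmxA. Qed.

Lemma conj_adj (H N : 'M[C]_n) : H^t* = H -> N^t* = N ->
  (H *m N *m H)^t* = H *m N *m H.
Proof. by move=> HH NN; rewrite !adjmxM HH NN mulmxA. Qed.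

Lemma mul_cdiag_cancel U V W d : U \is unitarymx -> V \is unitarymx ->
  W *m (cdiag U d *m V^t*) *m (V *m U^t*) = W *m U^t* *m diag_mx d.
Proof.
move=> /unitarymxP Uu Vu; rewrite /cdiag !mulmxA -(mulmxA _ (V^t*)) unitarymx_adjK//.
by rewrite mulmx1 -(mulmxA _ U) Uu mulmx1.
Qed.

Lemma mul_cdiag_adj U V W d (x : 'cV[C]_n) :
  W *m (cdiag U d *m (V^t* *m x)) = W *m U^t* *m diag_mx d *m (U *m V^t*) *m x.
Proof. by rewrite /cdiag !mulmxA. Qed.

End UnitaryDiagonal.

Section Spectral.
Variables (R : realType) (n : nat).
Implicit Types (U V W : 'M[R[i]]_n) (a b : 'I_n -> R).

Definition crow a : 'rV[R[i]]_n := \row_i (a i)%:C.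

Definition unidiag U a : 'M[R[i]]_n := cdiag U (crow a).

Lemma unidiag_adj U a : (unidiag U a)^t* = unidiag U a.
Proof. by apply: cdiag_adj => i; rewrite mxE; exact: conjc_real. Qed.

Lemma eq_unidiag U a b : a =1 b -> unidiag U a = unidiag U b.
Proof. by move=> /funext ->. Qed.

Lemma unidiagM U a b : U \is unitarymx ->
  unidiag U a *m unidiag U b = unidiag U (fun i => a i * b i).
Proof.
move=> Uu; rewrite /unidiag (cdiagM _ _ Uu); congr cdiag.
by apply/rowP => i; rewrite !mxE rmorphM.
Qed.

Lemma unidiag1 U : U \is unitarymx -> unidiag U (fun=> 1) = 1%:M.
Proof.
move=> Uu; rewrite -(cdiag1 Uu); congr cdiag.
by apply/rowP => i; rewrite !mxE.
Qed.

Lemma unidiagZ U a (t : R) : t%:C *: unidiag U a = unidiag U (fun i => t * a i).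
Proof.
rewrite /unidiag cdiagZ; congr cdiag.
by apply/rowP => i; rewrite !mxE rmorphM.
Qed.

Lemma quadform_unidiag U a (x : 'cV[R[i]]_n) :
  (x^t* *m unidiag U a *m x) 0 0 = (\sum_i a i * nsq ((U *m x) i 0))%:C.
Proof.
rewrite quadform_cdiag rmorph_sum /=; apply: eq_bigr => i _.
by rewrite mxE rmorphM /= nsqE.
Qed.

Lemma mxtrace_unidiag U V a b :
  \tr (unidiag U a *m unidiag V b) =
  (\sum_i \sum_l a i * (b l * nsq ((V *m U^t*) l i)))%:C.
Proof.
rewrite mxtrace_cdiag rmorph_sum /=; apply: eq_bigr => i _.
rewrite rmorph_sum /=; apply: eq_bigr => l _.
by rewrite [crow a 0 i]mxE [crow b 0 l]mxE !rmorphM /= nsqE.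
Qed.

(** This frees the functional calculus from the particular diagonalisation chosen by
    [spectralmx]. *)
Lemma mxfun_unidiag U a (f : R -> R) : U \is unitarymx ->
  mxfun f (unidiag U a) = unidiag U (f \o a).
Proof.
move=> Uu; have Su := spectral_unitarymx (unidiag U a).
have [AE _] := hermitian_cdiag (unidiag_adj U a).
rewrite /mxfun cdiag_spectral.
have := cdiag_map (fun z => (f (complex.Re z))%:C) Su Uu (esym AE).
move=> ->; congr cdiag.
by apply/rowP => i; rewrite !mxE.
Qed.

Lemma hermitian_unidiag (A : 'M[R[i]]_n) : A^t* = A ->
  exists U a, U \is unitarymx /\ A = unidiag U a.
Proof.
move=> /hermitian_cdiag[AE dr].
exists (spectralmx A), (fun i => complex.Re (spectral_diag A 0 i)).
split; first exact: spectral_unitarymx.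
rewrite {1}AE; congr cdiag; apply/rowP => i; rewrite mxE.
by rewrite RRe_real.
Qed.

Lemma psdmx_adj (A : 'M[R[i]]_n) : psdmx A -> A^t* = A.
Proof. by case=> /hermsymmxE. Qed.

Lemma psdmx_unidiag_ge0 U a : U \is unitarymx -> psdmx (unidiag U a) ->
  forall i, 0 <= a i.
Proof.
move=> Uu [_ H] i; have := H (U^t* *m delta_mx i 0).
by rewrite cdiag_conj_entry// mxE ler0c.
Qed.

Lemma psdmx_unidiag U a : (forall i, 0 <= a i) -> psdmx (unidiag U a).
Proof.
move=> a0; split; first exact/hermsymmxE/unidiag_adj.
move=> v; rewrite quadform_unidiag ler0c sumr_ge0// => i _.
by rewrite mulr_ge0 ?nsq_ge0.
Qed.

Lemma psdmxP (A : 'M[R[i]]_n) : psdmx A ->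
  exists U a, [/\ U \is unitarymx, forall i, 0 <= a i & A = unidiag U a].
Proof.
move=> Ap; have [U [a [Uu AE]]] := hermitian_unidiag (psdmx_adj Ap).
exists U, a; split=> //; apply: (psdmx_unidiag_ge0 Uu).
by rewrite -AE.
Qed.

Lemma quadform_congr U W a b (x : 'cV[R[i]]_n) :
  (x^t* *m (unidiag U a *m unidiag W b *m unidiag U a) *m x) 0 0 =
  (\sum_i b i * nsq ((W *m (unidiag U a *m x)) i 0))%:C.
Proof.
by rewrite (quadform_conj _ _ (unidiag_adj U a)) quadform_unidiag.
Qed.

Lemma unidiag_congr_psd U W a b : (forall i, 0 <= b i) ->
  psdmx (unidiag U a *m unidiag W b *m unidiag U a).
Proof.
move=> b0; split.
  by apply/hermsymmxE/conj_adj; exact: unidiag_adj.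
move=> v; rewrite quadform_congr ler0c sumr_ge0// => i _.
by rewrite mulr_ge0 ?nsq_ge0.
Qed.

Lemma unidiag_congrP U W a b : (forall i, 0 <= b i) ->
  exists V m, [/\ V \is unitarymx, forall i, 0 <= m i &
    unidiag U a *m unidiag W b *m unidiag U a = unidiag V m].
Proof. by move=> b0; exact/psdmxP/unidiag_congr_psd. Qed.

(** Both sides are evaluated on the [l]-th eigenvector; expanding in the basis [U] produces the
    expression for [m] used in the pinching argument. *)
Lemma unidiag_congr_eigenvalue U W V a b (m : 'I_n -> R) : V \is unitarymx ->
  unidiag U a *m unidiag W b *m unidiag U a = unidiag V m ->
  forall l, m l =
    \sum_i b i * nsq (\sum_j (W *m U^t*) i j * (a j)%:C * (U *m V^t*) j l).
Proof.
move=> Vu H l; apply: (@complexI R).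
have := cdiag_conj_entry (crow m) l Vu; rewrite -/(unidiag V m) [crow m 0 l]mxE => <-.
rewrite -H quadform_congr.
congr (_%:C); apply: eq_bigr => i _; congr (_ * nsq _).
rewrite mul_cdiag_adj.
move: (W *m U^t*) (U *m V^t*) => X Y.
rewrite -colE mxE mxE; apply: eq_bigr => j _.
by rewrite mul_mx_diag !mxE.
Qed.

End Spectral.

(** * The Araki-Lieb-Thirring inequality *)

Section MatrixFacts.
Variables (C : numClosedFieldType) (n : nat).
Implicit Types (U V W X Y : 'M[C]_n).

Lemma congr_mulV X X' Y Y' : X *m X' = 1%:M -> Y *m Y' = 1%:M ->
  (X *m Y *m X) *m (X' *m Y' *m X') = 1%:M.
Proof.
move=> XX YY; rewrite !mulmxA -(mulmxA _ X X') XX mulmx1.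
by rewrite -(mulmxA _ Y Y') YY mulmx1.
Qed.

Lemma congrK X X' Y : X *m X' = 1%:M -> X' *m X = 1%:M ->
  X *m (X' *m Y *m X') *m X = Y.
Proof. by move=> XX XX'; rewrite !mulmxA XX mul1mx -mulmxA XX' mulmx1. Qed.

Lemma right_inv_eq X X' Y : X' *m X = 1%:M -> X *m Y = 1%:M -> Y = X'.
Proof. by move=> X'X XY; rewrite -[LHS]mul1mx -X'X -mulmxA XY mulmx1. Qed.

Lemma cdiag_inv_neq0 U (d : 'rV[C]_n) X k : cdiag U d *m X = 1%:M -> d 0 k != 0.
Proof.
case/mulmx1_unit => H _; move: H; rewrite /cdiag !unitmx_mul => /andP[/andP[_ H] _].
by move: H; rewrite unitmxE det_diag unitfE prodf_seq_neq0 => /allP/(_ k);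
  apply; rewrite mem_index_enum.
Qed.

Lemma mxtrace_congr X Y B : \tr ((X *m Y *m X) *m B) = \tr (Y *m (X *m B *m X)).
Proof. by rewrite -!mulmxA mxtrace_mulC -!mulmxA. Qed.

Lemma mxtrace_cdiag1 U (d : 'rV[C]_n) : U \is unitarymx ->
  \tr (cdiag U d) = \sum_i d 0 i.
Proof.
by move=> Uu; rewrite /cdiag -mulmxA mxtrace_mulC -mulmxA (unitarymxP Uu) mulmx1 mxtrace_diag.
Qed.

Lemma mulC_mulC U V W : V \is unitarymx ->
  (U *m V^t*) *m (V *m W^t*) = U *m W^t*.
Proof. by move=> Vu; rewrite mulmxA -(mulmxA U) unitarymx_adjK// mulmx1. Qed.

End MatrixFacts.

Section Inequalities.
Variables (R : realType) (n : nat).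
Implicit Types (U V W Q : 'M[R[i]]_n) (a b m : 'I_n -> R).

Lemma unidiagVV U a : U \is unitarymx -> (forall i, a i != 0) ->
  unidiag U a *m unidiag U (fun i => (a i)^-1) = 1%:M.
Proof.
move=> Uu an; rewrite unidiagM// -(unidiag1 Uu); apply: eq_unidiag => i.
by rewrite divff.
Qed.

Lemma unidiagVVl U a : U \is unitarymx -> (forall i, a i != 0) ->
  unidiag U (fun i => (a i)^-1) *m unidiag U a = 1%:M.
Proof.
move=> Uu an; rewrite unidiagM// -(unidiag1 Uu); apply: eq_unidiag => i.
by rewrite mulVf.
Qed.

Lemma mxtrace_unidiag1 U a : U \is unitarymx ->
  \tr (unidiag U a) = (\sum_i a i)%:C.
Proof.
move=> Uu; rewrite mxtrace_cdiag1// rmorph_sum; apply: eq_bigr => i _.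
by rewrite mxE.
Qed.

Lemma araki_lieb_thirring_gt1 U W V a b m s :
  U \is unitarymx -> W \is unitarymx -> V \is unitarymx ->
  (forall i, 0 <= a i) -> (forall i, 0 <= b i) ->
  unidiag U (fun i => Num.sqrt (a i)) *m unidiag W b *m
    unidiag U (fun i => Num.sqrt (a i)) = unidiag V m ->
  1 < s ->
  \sum_l m l `^ s <=
  \sum_i \sum_j b i `^ s * a j `^ s * nsq ((W *m U^t*) i j).
Proof.
move=> Uu Wu Vu a0 b0 H s1.
under eq_bigr do rewrite (unidiag_congr_eigenvalue Vu H).
exact: (alt_gt1 (unitary_mulC Wu Uu) (unitary_mulC Uu Vu) (lt_trans ltr01 s1) a0 b0 s1).
Qed.

Lemma araki_lieb_thirring_ge_half U W V a b m s :
  U \is unitarymx -> W \is unitarymx -> V \is unitarymx ->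
  (forall i, 0 <= a i) -> (forall i, 0 <= b i) ->
  unidiag U (fun i => Num.sqrt (a i)) *m unidiag W b *m
    unidiag U (fun i => Num.sqrt (a i)) = unidiag V m ->
  2^-1 <= s < 1 ->
  \sum_i \sum_j b i `^ s * a j `^ s * nsq ((W *m U^t*) i j) <=
  \sum_l m l `^ s.
Proof.
move=> Uu Wu Vu a0 b0 H s1.
under [leRHS]eq_bigr do rewrite (unidiag_congr_eigenvalue Vu H).
have s0 : 0 < s by case/andP: s1 => + _; apply: lt_le_trans; rewrite invr_gt0.
exact: (alt_lt1 (unitary_mulC Wu Uu) (unitary_mulC Uu Vu) s0 a0 b0 s1).
Qed.

(* [tr A^s B^s <= s tr G B + (1 - s) tr G^-u A^u], where [G = Q^* diag(g) Q]. *)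
Lemma trace_young U W Q a b g s (u := s / (1 - s)) :
  U \is unitarymx -> W \is unitarymx -> Q \is unitarymx -> 0 < s < 1 ->
  (forall i, 0 < a i) -> (forall i, 0 <= b i) -> (forall i, 0 < g i) ->
  \sum_i \sum_j b i `^ s * a j `^ s * nsq ((W *m U^t*) i j) <=
  s * (\sum_j \sum_i g j * (b i * nsq ((W *m Q^t*) i j))) +
  (1 - s) * (\sum_j \sum_l (g j)^-1 `^ u * a l `^ u * nsq ((Q *m U^t*) j l)).
Proof.
move=> Uu Wu Qu /[dup] s01 /andP[s0 s1] a0 b0 g0.
have WQ := unitary_mulC Wu Qu; have QU := unitary_mulC Qu Uu.
have au0 l : 0 < a l `^ u by rewrite powR_gt0.
(* Pinching in the eigenbasis of [G], with [K = 1] and the pair $A^u$, $B$: since $u(1-s) = s$, the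
   unpinched side is the trace of $A^s B^s$. *)
have := pinching_le WQ QU au0 b0 (fun=> 1) s01.
have E1 i l : \sum_j (W *m Q^t*) i j * 1 * (Q *m U^t*) j l = (W *m U^t*) i l.
  rewrite -(mulC_mulC W U Qu) mxE; apply: eq_bigr => j _.
  by rewrite mulr1.
have s1' : 1 - s != 0 by rewrite subr_eq0 gt_eqF.
have us : u - u * s = s by rewrite /u; field.
have E2 i l : a l `^ u * (b i / a l `^ u) `^ s = b i `^ s * a l `^ s.
  rewrite powRM ?invr_ge0 ?powR_ge0// mulrCA; congr (_ * _).
  rewrite -powR_inv1 ?powR_ge0// -!powRrM -powRD; last first.
    by rewrite (gt_eqF (a0 l)) implybT.
  by congr (_ `^ _); rewrite -[RHS]us; ring.
under eq_bigr do under eq_bigr do rewrite E1 E2.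
move=> H; apply: (le_trans H) => {H}.
rewrite !mulr_sumr -big_split /=; apply: ler_sum => j _.
set B := \sum_l a l `^ u * nsq ((Q *m U^t*) j l).
set D := \sum_i b i * nsq ((W *m Q^t*) i j).
have B0 : 0 < B := weighted_row_gt0 j QU au0.
have D0 : 0 <= D by rewrite sumr_ge0// => i _; rewrite mulr_ge0 ?nsq_ge0.
rewrite -mulr_sumr -/D.
have -> : \sum_l (g j)^-1 `^ u * a l `^ u * nsq ((Q *m U^t*) j l) = (g j)^-1 `^ u * B.
  by rewrite mulr_sumr; apply: eq_bigr => l _; rewrite mulrA.
have -> : nsq (1 : R[i]) = 1 by rewrite (_ : 1 = 1%:C)// nsqC expr1n.
rewrite mulr1.
set v := g j `^ u; have v0 : 0 < v by rewrite powR_gt0.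
have vE : (g j)^-1 `^ u = v^-1.
  by rewrite -(powR_inv1 (ltW (g0 j))) powRAC powR_inv1// powR_ge0.
rewrite vE.
have gE : (g j * v) `^ s = v.
  rewrite powRM ?(ltW (g0 j)) ?(ltW v0)// /v -powRrM -powRD; last first.
    by rewrite (gt_eqF (g0 j)) implybT.
  by congr (_ `^ _); rewrite -[X in X + _]us subrK.
have DB0 : 0 <= D / B by rewrite divr_ge0 ?(ltW B0).
have gv0 : 0 <= g j * v := mulr_ge0 (ltW (g0 j)) (ltW v0).
have z0 : 0 <= g j * v * (D / B) := mulr_ge0 gv0 DB0.
(* Bernoulli at $z = g^{1+u} D/B$, multiplied by $B/g^u$. As $s(1+u) = u$, the powers of $g$ cancel
   on the left. *)
have := ler_wpM2l (ltW (divr_gt0 B0 v0)) (bernoulli_powR_le s01 z0).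
rewrite (powRM _ gv0 DB0) gE => H.
have -> : B * (D / B) `^ s = B / v * (v * (D / B) `^ s).
  by field; rewrite gt_eqF.
apply: (le_trans H); rewrite le_eqVlt; apply/orP; left; apply/eqP.
by field; rewrite !gt_eqF.
Qed.

(** Induction along $1/u = 1/s - 1$, which turns $s \ge 1/(k+3)$ into $u \ge 1/(k+2)$. Off the
    kernel of [M], take $G = A^{1/2} M^{s-1} A^{1/2}$ in [trace_young]: the trace of $GB$ is that of
    $M^s$, and the sandwich of $G^{-1}$ by $A^{1/2}$ is $M^{1-s}$, whose $u$-th power is $M^s$. *)
Lemma araki_lieb_thirring_lt1 k U W V a b m s :
  U \is unitarymx -> W \is unitarymx -> V \is unitarymx ->
  (forall i, 0 < a i) -> (forall i, 0 <= b i) ->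
  unidiag U (fun i => Num.sqrt (a i)) *m unidiag W b *m
    unidiag U (fun i => Num.sqrt (a i)) = unidiag V m ->
  k.+2%:R^-1 <= s < 1 ->
  \sum_i \sum_j b i `^ s * a j `^ s * nsq ((W *m U^t*) i j) <=
  \sum_l m l `^ s.
Proof.
elim: k s U W V a b m => [|k IH] s U W V a b m Uu Wu Vu a0 b0 H /andP[sk s1].
  apply: (araki_lieb_thirring_ge_half Uu Wu Vu _ b0 H); last by rewrite sk.
  by move=> i; rewrite ltW.
have [s2|s2] := leP 2^-1 s.
  apply: (araki_lieb_thirring_ge_half Uu Wu Vu _ b0 H); last by rewrite s2.
  by move=> i; rewrite ltW.
have m0 : forall l, 0 <= m l.
  by apply: (psdmx_unidiag_ge0 Vu); rewrite -H; exact: unidiag_congr_psd.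
have s0 : 0 < s by apply: lt_le_trans sk; rewrite invr_gt0.
apply: (@le_of_le_add_mulrn R _ _ 1 n ler01) => e e0; rewrite mul1r.
pose u := s / (1 - s).
have s1' : 0 < 1 - s by rewrite subr_gt0.
have u0 : 0 < u by rewrite divr_gt0.
(* [y] and [g] are the eigenvalues of [Y = M^(s-1)] and of [A^{1/2} Y A^{1/2}]. *)
pose y l := if m l == 0 then e `^ (- u^-1) else m l `^ (s - 1).
have mpos l : m l != 0 -> 0 < m l by move=> ml; rewrite lt0r ml m0.
have y0 l : 0 < y l.
  by rewrite /y; case: eqVneq => [_|/mpos]; exact: powR_gt0.
have yn l : y l != 0 by rewrite gt_eqF.
have ym l : y l * m l = m l `^ s.
  rewrite /y; case: eqVneq => [->|_]; first by rewrite mulr0 powR0 ?gt_eqF.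
  by rewrite mulrC mulr_powRB1.
(* On the kernel of [M] the value of [y] is the one for which $(y^{-1})^u = e$. *)
have yu l : (y l)^-1 `^ u <= m l `^ s + e.
  rewrite -(powR_inv1 (ltW (y0 l))) -powRrM /y.
  case: eqVneq => [->|/mpos ml].
    rewrite -powRrM (_ : - u^-1 * _ = 1); last by field; rewrite gt_eqF.
    by rewrite powRr1 ?(ltW e0)// lerDr powR_ge0.
  rewrite -powRrM (_ : (s - 1) * _ = s) ?lerDl ?(ltW e0)//.
  by rewrite /u; field; rewrite gt_eqF.
pose r i := Num.sqrt (a i).
have rn i : r i != 0 by rewrite gt_eqF// sqrtr_gt0.
have [Q [g [Qu g_ge0 HQ]]] := unidiag_congrP U V r (fun l => ltW (y0 l)).
have gG : unidiag Q g *m (unidiag U (fun i => (r i)^-1) *m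
    unidiag V (fun l => (y l)^-1) *m unidiag U (fun i => (r i)^-1)) = 1%:M.
  by rewrite -HQ; apply: congr_mulV; exact: unidiagVV.
have gn j : g j != 0.
  by have := cdiag_inv_neq0 j gG; rewrite mxE (inj_eq (@complexI R)).
have g0 j : 0 < g j by rewrite lt0r gn g_ge0.
have GE : unidiag U (fun i => (r i)^-1) *m unidiag V (fun l => (y l)^-1) *m
    unidiag U (fun i => (r i)^-1) = unidiag Q (fun j => (g j)^-1).
  exact: right_inv_eq (unidiagVVl Qu gn) gG.
have HY : unidiag U r *m unidiag Q (fun j => (g j)^-1) *m unidiag U r =
          unidiag V (fun l => (y l)^-1).
  by rewrite -GE; apply: congrK; [exact: unidiagVV|exact: unidiagVVl].
apply: (le_trans (trace_young Uu Wu Qu _ a0 b0 g0)); first by rewrite s0.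
have T1 : \sum_j \sum_i g j * (b i * nsq ((W *m Q^t*) i j)) = \sum_l m l `^ s.
  apply: (@complexI R); rewrite -mxtrace_unidiag -HQ mxtrace_congr H.
  by rewrite unidiagM// mxtrace_unidiag1//; congr (_%:C); apply: eq_bigr => l _.
have T2 : \sum_j \sum_l (g j)^-1 `^ u * a l `^ u * nsq ((Q *m U^t*) j l) <=
    \sum_l m l `^ s + e *+ n.
  apply: (@le_trans _ _ (\sum_l (y l)^-1 `^ u)).
    apply: (IH u U Q V a (fun j => (g j)^-1)) => //.
      by move=> j; rewrite invr_ge0.
    rewrite /u ler_pdivlMr// ltr_pdivrMr// mul1r.
    have k0 : 0 < k.+2%:R :> R by [].
    rewrite mulrC ler_pdivrMr//.
    have sk' : 1 <= s * k.+3%:R by rewrite -ler_pdivrMr// mul1r.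
    have kE : k.+3%:R = k.+2%:R + 1 :> R by rewrite -natr1.
    by rewrite kE in sk'; apply/andP; split; lra.
  have -> : e *+ n = \sum_(l < n) e by rewrite sumr_const card_ord.
  by rewrite -big_split /=; apply: ler_sum.
have T0 : 0 <= \sum_l m l `^ s by apply: sumr_ge0 => l _; exact: powR_ge0.
have en : 0 <= e *+ n by rewrite mulrn_wge0 ?(ltW e0).
rewrite T1 -/u.
set T := \sum_l m l `^ s in T0 T2 *; set E := e *+ n in en T2 *.
apply: (le_trans (lerD (lexx _) (ler_wpM2l (ltW s1') T2))).
by nra.
Qed.

End Inequalities.

(** * Hansen's inequality and cuts of the spectrum *)

(** Induction on the support of [f], which by monotonicity is a set of the form $a_k \le a_i$.
    Subtracting the least positive value of [f] there leaves a nonnegative monotone function of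
    smaller support. *)
Lemma layer_cake_ge0 (R : realType) (I : finType) (a f g : I -> R) :
  (forall i, 0 <= f i) -> (forall i j, a i <= a j -> f i <= f j) ->
  (forall k, 0 < f k -> 0 <= \sum_(i | a k <= a i) g i) ->
  0 <= \sum_i f i * g i.
Proof.
elim: {f}_.+1 {-2}f (ltnSn #|[pred i | f i != 0%R]|) => // c IH f fc f0 fmono fg.
case: (pickP (fun i => f i != 0)) => [k0 k0P|none]; last first.
  by rewrite big1// => i _; have /eqP -> := negbFE (none i); rewrite mul0r.
pose k := [arg min_(i < k0 | f i != 0) a i]%O.
have [kP kmin] : f k != 0 /\ forall j, f j != 0 -> a k <= a j.
  by rewrite /k; case: arg_minP.
have fk : 0 < f k by rewrite lt0r kP f0.
have supp i : (f i != 0) = (a k <= a i).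
  apply/idP/idP => [/kmin//|/fmono fki].
  by rewrite gt_eqF// (lt_le_trans fk).
pose h i := if a k <= a i then f i - f k else 0.
have -> : \sum_i f i * g i = f k * (\sum_(i | a k <= a i) g i) + \sum_i h i * g i.
  rewrite mulr_sumr [X in X + _]big_mkcond -big_split /=; apply: eq_bigr => i _.
  rewrite /h -supp; case: eqVneq => [->|_] /=; first by rewrite !mul0r addr0.
  ring.
apply: addr_ge0; first by rewrite mulr_ge0 ?(ltW fk)// fg.
apply: IH.
- rewrite ltnS in fc; apply: leq_trans fc; apply: proper_card; apply/properP; split.
    apply/fintype.subsetP => i; rewrite !inE /h supp.
    by case: ifP => //; rewrite eqxx.
  by exists k; rewrite inE ?kP// /h lexx subrr eqxx.
- by move=> i; rewrite /h; case: ifP => // /fmono; rewrite subr_ge0.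
- move=> i j ij; rewrite /h; case: ifP => [ki|_].
    by rewrite (le_trans ki ij) lerD2r fmono.
  by case: ifP => // /fmono; rewrite subr_ge0.
- move=> i; rewrite /h; case: ifP => [ki|]; last by rewrite ltxx.
  by rewrite subr_gt0 => fki; apply: fg; rewrite (lt_trans fk).
Qed.

Section VectorNorm.
Variables (R : realType) (n : nat).

Lemma vnsq_unitary (U : 'M[R[i]]_n) (x : 'cV[R[i]]_n) : U \is unitarymx ->
  \sum_i nsq ((U *m x) i 0) = \sum_i nsq (x i 0).
Proof.
move=> Uu; rewrite -(parseval (fun j => x j 0) Uu); apply: eq_bigr => i _.
by rewrite mxE.
Qed.

Lemma unidiagE (U : 'M[R[i]]_n) a (x : 'cV[R[i]]_n) :
  unidiag U a *m x = U^t* *m (diag_mx (crow a) *m (U *m x)).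
Proof. by rewrite /unidiag /cdiag -!mulmxA. Qed.

Lemma vnsq_unidiag (U W : 'M[R[i]]_n) a (x : 'cV[R[i]]_n) :
  U \is unitarymx -> W \is unitarymx ->
  \sum_i nsq ((W *m (unidiag U a *m x)) i 0) =
  \sum_i nsq ((diag_mx (crow a) *m (U *m x)) i 0).
Proof.
move=> Uu Wu; rewrite (vnsq_unitary _ Wu) unidiagE.
exact: vnsq_unitary (etrans (trmxC_unitary U) Uu).
Qed.

End VectorNorm.

Section Hansen.
Variables (R : realType) (n : nat).
Variables (U V W : 'M[R[i]]_n) (d m m' : 'I_n -> R) (i : 'I_n).
Hypotheses (Uu : U \is unitarymx) (Vu : V \is unitarymx) (Wu : W \is unitarymx).
Hypotheses (d01 : forall j, 0 <= d j <= 1) (di : d i = 1).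
Hypotheses (m0 : forall l, 0 <= m l) (m'0 : forall l, 0 <= m' l).
Hypothesis H : unidiag U d *m unidiag W m' *m unidiag U d = unidiag V m.

(** The contraction [D = unidiag U d], written from the eigenbasis of [D M' D] to that of [M']. *)
Let T l k := (W *m (unidiag U d *m V^t*)) l k.

Let TE (y : 'I_n -> R[i]) l : \sum_k T l k * y k =
  (W *m (unidiag U d *m (V^t* *m \col_k y k))) l 0.
Proof.
rewrite (mulmxA (unidiag U d)) (mulmxA W) mxE; apply: eq_bigr => k _.
by congr (_ * _); rewrite mxE.
Qed.

Let colE y : \sum_k nsq ((\col_k y k : 'cV[R[i]]_n) k 0) = \sum_k nsq (y k).
Proof. by apply: eq_bigr => k _; rewrite mxE. Qed.

Let contraction (y : 'I_n -> R[i]) :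
  \sum_l 1 * nsq (\sum_k T l k * y k) <= \sum_k 1 * nsq (y k).
Proof.
under eq_bigr do rewrite mul1r TE; under [leRHS]eq_bigr do rewrite mul1r.
have -> : \sum_k nsq (y k) = \sum_i nsq ((U *m (V^t* *m \col_k y k)) i 0).
  by rewrite (vnsq_unitary _ Uu) (vnsq_unitary _ (etrans (trmxC_unitary V) Vu)) colE.
rewrite [leLHS](vnsq_unidiag d (V^t* *m \col_k y k) Uu Wu).
move: (U *m (V^t* *m \col_k y k)) => z. apply: ler_sum => j _.
rewrite mul_diag_mx mxE [crow d 0 j]mxE nsqM nsqC.
have /andP[dj0 dj1] := d01 j.
by rewrite ler_piMl ?nsq_ge0// expr_le1.
Qed.

Let isometry (y : 'I_n -> R[i]) :
  \sum_l m' l * nsq (\sum_k T l k * y k) = \sum_k m k * nsq (y k).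
Proof.
under eq_bigr do rewrite TE.
apply: (@complexI R); rewrite -quadform_congr H quadform_unidiag.
rewrite mulmxA (unitarymxP Vu) mul1mx.
by congr (_%:C); apply: eq_bigr => k _; rewrite mxE.
Qed.

Let x k := (V *m U^t*) k i.

Let Tx l : \sum_k T l k * x k = (W *m U^t*) l i.
Proof.
have -> : \sum_k T l k * x k = (W *m (unidiag U d *m V^t*) *m (V *m U^t*)) l i.
  by rewrite mxE.
have -> : W *m (unidiag U d *m V^t*) *m (V *m U^t*) = W *m U^t* *m diag_mx (crow d).
  exact: (mul_cdiag_cancel W (crow d) Uu Vu).
by rewrite mul_mx_diag mxE [crow d 0 i]mxE di mulr1.
Qed.

(** Hansen's inequality $D M'^s D \le (D M' D)^s$, tested on a basis vector fixed by [D]. It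
    interpolates between the unit weights, where [T] is a contraction, and the weights [m'], [m],
    where it is an isometry. *)
Lemma hansen_lt1 s : 0 < s < 1 ->
  \sum_l m' l `^ s * nsq ((W *m U^t*) l i) <=
  \sum_l m l `^ s * nsq ((V *m U^t*) l i).
Proof.
move=> s01; have iso y : \sum_l m' l * nsq (\sum_k T l k * y k) <= \sum_k m k * nsq (y k).
  by rewrite isometry.
have := @quadratic_interpolation_le R _ _ T (fun=> 1) m' (fun=> 1) m s
  (fun=> ltr01) m'0 (fun=> ltr01) m0 contraction x s01 iso.
under eq_bigr do rewrite mul1r divr1 Tx.
by under [leRHS]eq_bigr do rewrite mul1r divr1.
Qed.

Lemma hansen_gt1 s : 1 < s <= 2 ->
  \sum_l m l `^ s * nsq ((V *m U^t*) l i) <=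
  \sum_l m' l `^ s * nsq ((W *m U^t*) l i).
Proof.
move=> s12.
have := @quadratic_interpolation_ge R _ _ T (fun=> 1) m' (fun=> 1) m s
  (fun=> ltr01) m'0 (fun=> ltr01) m0 contraction x s12 isometry.
under eq_bigr do rewrite mul1r divr1.
by under [leRHS]eq_bigr do rewrite mul1r divr1 Tx.
Qed.

End Hansen.

Section MoreMatrixFacts.
Variables (C : numClosedFieldType) (n : nat).
Implicit Types (U V W X Y N : 'M[C]_n).

Lemma congr_congr X Y N : X *m (Y *m N *m Y) *m X = (X *m Y) *m N *m (Y *m X).
Proof. by rewrite !mulmxA. Qed.

Lemma cdiag_congr2 U N (d e : 'rV[C]_n) : U \is unitarymx ->
  cdiag U d *m (cdiag U e *m N *m cdiag U e) *m cdiag U d =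
  cdiag U (\row_i (d 0 i * e 0 i)) *m N *m cdiag U (\row_i (e 0 i * d 0 i)).
Proof. by move=> Uu; rewrite congr_congr !(cdiagM _ _ Uu). Qed.

Lemma congr_scalar (c : C) N : c%:M *m N *m c%:M = (c * c) *: N.
Proof. by rewrite mul_scalar_mx mul_mx_scalar scalerA. Qed.

Lemma cdiag_const U (c : C) : U \is unitarymx -> cdiag U (const_mx c) = c%:M.
Proof.
move=> Uu; rewrite /cdiag diag_const_mx mul_mx_scalar -scalemxAl unitarymx_adjK//.
by rewrite scalemx1.
Qed.

Lemma cdiag_eigenvector U (d : 'rV[C]_n) i : U \is unitarymx ->
  cdiag U d *m (U^t* *m delta_mx i 0 : 'cV_n) = d 0 i *: (U^t* *m delta_mx i 0).
Proof.
move=> Uu; rewrite /cdiag -!mulmxA (mulmxA U) (unitarymxP Uu) mul1mx.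
rewrite scalemxAr; congr (_ *m _); apply/colP => k.
rewrite mul_diag_mx !mxE; case: eqVneq => [->//|_] /=.
by rewrite !mulr0.
Qed.

Lemma cdiag_eigenvalue U (d : 'rV[C]_n) i : U \is unitarymx ->
  eigenvalue (cdiag U d) (d 0 i).
Proof.
move=> Uu; apply/eigenvalueP; exists (row i U).
  rewrite -row_mul /cdiag !mulmxA (unitarymxP Uu) mul1mx; apply/rowP => j.
  by rewrite mul_diag_mx !mxE.
apply/negP => /eqP U0; have /matrixP/(_ i i) := unitarymxP Uu.
rewrite !mxE big1 ?eqxx => [/eqP|k _]; first by rewrite eq_sym oner_eq0.
by have /rowP/(_ k) := U0; rewrite !mxE => ->; rewrite mul0r.
Qed.

Lemma eigenvalue_cdiag U (d : 'rV[C]_n) z : U \is unitarymx ->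
  eigenvalue (cdiag U d) z -> exists i, z = d 0 i.
Proof.
move=> Uu /eigenvalueP[v vE v0]; pose w := v *m U^t*.
have wE : w *m diag_mx d = z *: w.
  rewrite /w scalemxAl -vE /cdiag !mulmxA -(mulmxA _ U) (unitarymxP Uu).
  by rewrite mulmx1.
have /rV0Pn[k wk] : w != 0.
  apply: contraNneq v0 => w0; have := congr1 (mulmx^~ U) w0.
  by rewrite /w -mulmxA unitarymx_adjK// mulmx1 mul0mx => ->.
exists k; apply: (mulIf wk); have /rowP/(_ k) := wE.
by rewrite mul_mx_diag !mxE => <-; rewrite mulrC.
Qed.

End MoreMatrixFacts.

(** Below the cut the terms satisfy the opposite inequality $q' \le t^s p$, so removing them from
    the total leaves an inequality above the cut, where $q' \le q$. *)
Lemma sum_threshold (R : realType) (n : nat) (a p q q' : 'I_n -> R) (t s : R) :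
  (forall i, t <= a i -> q' i <= q i) ->
  (forall i, a i <= t -> q' i <= t `^ s * p i) ->
  \sum_i (Num.max (a i) t) `^ s * p i <= \sum_i q' i ->
  \sum_(i | t <= a i) a i `^ s * p i <= \sum_(i | t <= a i) q i.
Proof.
move=> h1 h2; rewrite (bigID (fun i => t <= a i)) /= [leRHS](bigID (fun i => t <= a i)) /=.
have -> : \sum_(i | t <= a i) Num.max (a i) t `^ s * p i = \sum_(i | t <= a i) a i `^ s * p i.
  by apply: eq_bigr => i /max_l ->.
have -> : \sum_(i | ~~ (t <= a i)) Num.max (a i) t `^ s * p i =
          \sum_(i | ~~ (t <= a i)) t `^ s * p i.
  by apply: eq_bigr => i; rewrite -ltNge => /ltW/max_r ->.
have l1 : \sum_(i | t <= a i) q' i <= \sum_(i | t <= a i) q i by exact: ler_sum.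
have l2 : \sum_(i | ~~ (t <= a i)) q' i <= \sum_(i | ~~ (t <= a i)) t `^ s * p i.
  by apply: ler_sum => i; rewrite -ltNge => /ltW/h2.
move: l1 l2; lra.
Qed.

Lemma crowM (R : realType) (n : nat) (c d : 'I_n -> R) :
  \row_i (crow c 0 i * crow d 0 i) = crow (fun i => c i * d i).
Proof. by apply/rowP => i; rewrite !mxE rmorphM. Qed.

Lemma unidiag_congr2 (R : realType) (n : nat) (U N : 'M[R[i]]_n) (c d : 'I_n -> R) :
  U \is unitarymx ->
  unidiag U c *m (unidiag U d *m N *m unidiag U d) *m unidiag U c =
  unidiag U (fun i => c i * d i) *m N *m unidiag U (fun i => d i * c i).
Proof. by move=> Uu; rewrite /unidiag (cdiag_congr2 _ _ _ Uu) !crowM. Qed.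

(** * Cuts of the spectrum of [A], and monotone weights *)

Section Threshold.
Variables (R : realType) (n : nat).
Variables (U W V : 'M[R[i]]_n) (a b m : 'I_n -> R).
Hypotheses (Uu : U \is unitarymx) (Wu : W \is unitarymx) (Vu : V \is unitarymx).
Hypotheses (a0 : forall i, 0 <= a i) (b0 : forall i, 0 <= b i).
Hypothesis H : unidiag U (fun i => Num.sqrt (a i)) *m unidiag W b *m
    unidiag U (fun i => Num.sqrt (a i)) = unidiag V m.

(* The diagonal entries, in the eigenbasis [U] of [A], of the [s]-th power of the
   matrix with eigenbasis [X] and eigenvalues [c]. *)
Definition powdiag (X : 'M[R[i]]_n) (c : 'I_n -> R) (s : R) i :=
  \sum_l c l `^ s * nsq ((X *m U^t*) l i).

Lemma sandwich_eigenvalue_ge0 l : 0 <= m l.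
Proof.
move: l; apply: (psdmx_unidiag_ge0 Vu).
by rewrite -H; exact: unidiag_congr_psd.
Qed.
Let m0 := sandwich_eigenvalue_ge0.

(** The [i]-th basis vector is an eigenvector of $A^{1/2}$ for $\sqrt{a_i}$, so the factors
    $A^{1/2}$ come out of the quadratic form. *)
Lemma sandwich_diag i :
  \sum_l m l * nsq ((V *m U^t*) l i) = a i * \sum_l b l * nsq ((W *m U^t*) l i).
Proof.
pose x : 'cV[R[i]]_n := U^t* *m delta_mx i 0.
have mulx (X : 'M[R[i]]_n) l : (X *m x) l 0 = (X *m U^t*) l i.
  by rewrite /x mulmxA -colE mxE.
have Ax : unidiag U (fun i => Num.sqrt (a i)) *m x = (Num.sqrt (a i))%:C *: x.
  by rewrite /unidiag (cdiag_eigenvector _ _ Uu) [crow _ 0 i]mxE.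
apply: (@complexI R).
under eq_bigr do rewrite -mulx.
rewrite -quadform_unidiag -H quadform_congr Ax; congr (_%:C); rewrite mulr_sumr.
apply: eq_bigr => l _; rewrite -scalemxAr mxE nsqM nsqC sqr_sqrtr// mulx.
by rewrite mulrCA.
Qed.

(** A vanishing diagonal entry of the positive semidefinite [M] means that the basis vector lies in
    its kernel. Hence the eigenvalue 0 of [A] contributes nothing, and cuts at positive levels
    suffice. *)
Lemma sandwich_kernel s i : 0 < s -> a i = 0 -> powdiag V m s i = 0.
Proof.
move=> s0 ai; have := sandwich_diag i; rewrite ai mul0r => /eqP.
rewrite psumr_eq0 => [/allP h|l _]; last by rewrite mulr_ge0 ?nsq_ge0.
apply: big1 => l _; have := h l (mem_index_enum l); rewrite mulf_eq0.
by case/orP => /eqP ->; rewrite ?mulr0// powR0 ?gt_eqF// mul0r.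
Qed.

Lemma sum_powdiag (X : 'M[R[i]]_n) c s : X \is unitarymx ->
  \sum_i powdiag X c s i = \sum_l c l `^ s.
Proof.
move=> Xu; rewrite exchange_big /=; apply: eq_bigr => l _.
by rewrite -mulr_sumr (unitary_row_nsq l (unitary_mulC Xu Uu)) mulr1.
Qed.

Section Cut.
Variable t : R.
Hypothesis t0 : 0 < t.

Let a' i := Num.max (a i) t.
Let a'0 i : 0 < a' i. Proof. by rewrite lt_max t0 orbT. Qed.
(** The eigenvalues of $A'^{1/2}$ and of the two contractions [d], [e], for which [d i * r i] is
    $\sqrt{a_i}$ and [e i * r i] is $\sqrt t$. *)
Let r i := Num.sqrt (a' i).
Let d i := Num.sqrt (a i / a' i).
Let e i := Num.sqrt (t / a' i).

Let sqrt01 (x y : R) : 0 <= x -> x <= y -> 0 < y -> 0 <= Num.sqrt (x / y) <= 1.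
Proof.
move=> x0 xy y0; rewrite sqrtr_ge0 -[leRHS]sqrtr1 ler_wsqrtr//.
by rewrite ler_pdivrMr// mul1r.
Qed.

Let d01 i : 0 <= d i <= 1. Proof. by apply: sqrt01; rewrite ?a0 ?a'0// le_max lexx. Qed.
Let e01 i : 0 <= e i <= 1.
Proof. by apply: sqrt01; rewrite ?(ltW t0) ?a'0// le_max lexx orbT. Qed.

Let d1 i : t <= a i -> d i = 1.
Proof.
move=> ta; rewrite /d /a' max_l// divff ?sqrtr1// gt_eqF//.
exact: lt_le_trans ta.
Qed.

Let e1 i : a i <= t -> e i = 1.
Proof. by move=> ta; rewrite /e /a' max_r// divff ?sqrtr1// gt_eqF. Qed.

Let sqrt_mul (x y : R) : 0 <= x -> 0 < y -> Num.sqrt (x / y) * Num.sqrt y = Num.sqrt x.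
Proof.
by move=> x0 y0; rewrite -sqrtrM ?divr_ge0 ?(ltW y0)// divfK// gt_eqF.
Qed.

Let cut_sandwich : exists V' m', [/\ V' \is unitarymx, forall i, 0 <= m' i,
  unidiag U r *m unidiag W b *m unidiag U r = unidiag V' m',
  unidiag U d *m unidiag V' m' *m unidiag U d = unidiag V m &
  unidiag U e *m unidiag V' m' *m unidiag U e = unidiag W (fun l => t * b l)].
Proof.
have [V' [m' [Vu' m'0 H']]] := unidiag_congrP U W r b0.
exists V', m'; split; [exact: Vu'|exact: m'0|exact: H'| |].
  have E : unidiag U (fun i => d i * r i) = unidiag U (fun i => Num.sqrt (a i)).
    by apply: eq_unidiag => i; rewrite sqrt_mul.
  have E' : unidiag U (fun i => r i * d i) = unidiag U (fun i => Num.sqrt (a i)).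
    by rewrite -E; apply: eq_unidiag => i; rewrite mulrC.
  by rewrite -H' (unidiag_congr2 _ _ _ Uu) E E'.
have E : unidiag U (fun i => e i * r i) = (Num.sqrt t)%:C%:M.
  rewrite -(cdiag_const _ Uu); congr cdiag; apply/rowP => i.
  by rewrite !mxE sqrt_mul// (ltW t0).
have E' : unidiag U (fun i => r i * e i) = (Num.sqrt t)%:C%:M.
  by rewrite -E; apply: eq_unidiag => i; rewrite mulrC.
rewrite -H' (unidiag_congr2 _ _ _ Uu) E E' congr_scalar -rmorphM unidiagZ.
by apply: eq_unidiag => i; rewrite -expr2 sqr_sqrtr// ltW.
Qed.

Let scaled_powdiag s i :
  \sum_l (t * b l) `^ s * nsq ((W *m U^t*) l i) = t `^ s * powdiag W b s i.
Proof.
rewrite mulr_sumr; apply: eq_bigr => l _.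
by rewrite powRM ?(ltW t0)// mulrA.
Qed.

Let sum_alt s : \sum_i a' i `^ s * powdiag W b s i =
  \sum_l \sum_i b l `^ s * a' i `^ s * nsq ((W *m U^t*) l i).
Proof.
rewrite [RHS]exchange_big /=; apply: eq_bigr => i _; rewrite mulr_sumr.
by apply: eq_bigr => l _; rewrite mulrCA mulrA.
Qed.

Lemma threshold_lt1 s : 0 < s < 1 ->
  \sum_(i | t <= a i) a i `^ s * powdiag W b s i <=
  \sum_(i | t <= a i) powdiag V m s i.
Proof.
move=> s01; have [V' [m' [Vu' m'0 H' HV HW]]] := cut_sandwich.
apply: (@sum_threshold _ _ _ _ _ (powdiag V' m' s)).
- by move=> i ta; exact: (hansen_lt1 Uu Vu Vu' d01 (d1 ta) m0 m'0 HV s01).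
- move=> i ta; rewrite -scaled_powdiag.
  have tb0 l : 0 <= t * b l by rewrite mulr_ge0 ?(ltW t0).
  exact: (hansen_lt1 Uu Wu Vu' e01 (e1 ta) tb0 m'0 HW s01).
rewrite sum_powdiag// sum_alt.
have /andP[s0 s1] := s01.
(* The reduction may start from any [k] with $1/(k+2) \le s$. *)
have sk : (Num.truncn s^-1).+2%:R^-1 <= s < 1.
  rewrite s1 andbT invf_ple ?posrE// ltW// (lt_trans (truncnS_gt _))//.
  by rewrite ltr_nat.
exact: (araki_lieb_thirring_lt1 Uu Wu Vu' a'0 b0 H' sk).
Qed.

Lemma threshold_gt1 s : 1 < s <= 2 ->
  \sum_(i | t <= a i) powdiag V m s i <=
  \sum_(i | t <= a i) a i `^ s * powdiag W b s i.
Proof.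
move=> s12; have [V' [m' [Vu' m'0 H' HV HW]]] := cut_sandwich.
(* All inequalities are reversed here, so the threshold argument is applied to the negated
   entries. *)
rewrite -lerN2 -!sumrN.
have := @sum_threshold R n a (fun i => - powdiag W b s i) (fun i => - powdiag V m s i)
  (fun i => - powdiag V' m' s i) t s.
under [X in _ -> _ -> _ -> X <= _]eq_bigr do rewrite mulrN.
apply.
- move=> i ta; rewrite lerN2.
  exact: (hansen_gt1 Uu Vu Vu' d01 (d1 ta) m0 m'0 HV s12).
- move=> i ta; rewrite mulrN lerN2 -scaled_powdiag.
  have tb0 l : 0 <= t * b l by rewrite mulr_ge0 ?(ltW t0).
  exact: (hansen_gt1 Uu Wu Vu' e01 (e1 ta) tb0 m'0 HW s12).
under eq_bigr do rewrite mulrN.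
rewrite !sumrN lerN2 sum_powdiag// sum_alt.
have /andP[s1 _] := s12.
exact: (araki_lieb_thirring_gt1 Uu Wu Vu' (fun i => ltW (a'0 i)) b0 H' s1).
Qed.

End Cut.

Section Weighted.
Variable f : R -> R.
Hypotheses (f0 : forall i, 0 <= f (a i)).
Hypothesis f_mono : forall i j, a i <= a j -> f (a i) <= f (a j).

(** Still monotone on the spectrum, as the eigenvalues are nonnegative, and positive only at
    positive levels. *)
Let f' i := if a i == 0 then 0 else f (a i).

Let weighted_layer_cake (g : 'I_n -> R) :
  (forall i, a i = 0 -> g i = 0) ->
  (forall t, 0 < t -> 0 <= \sum_(i | t <= a i) g i) ->
  0 <= \sum_i f (a i) * g i.
Proof.
move=> g0 gt.
have -> : \sum_i f (a i) * g i = \sum_i f' i * g i.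
  apply: eq_bigr => i _; rewrite /f'; case: eqVneq => // /g0 ->.
  by rewrite !mulr0.
apply: (@layer_cake_ge0 _ _ a) => [i|i j ij|k].
- by rewrite /f'; case: ifP.
- rewrite /f'; case: eqVneq => [_|ai]; case: eqVneq => [aj|_] //.
  + by move: ai; rewrite eq_le a0 -aj ij.
  + exact: f_mono.
- rewrite /f'; case: eqVneq => [_|ak]; first by rewrite ltxx.
  by move=> _; apply: gt; rewrite lt0r ak a0.
Qed.

Lemma weighted_lt1 s : 0 < s < 1 ->
  \sum_i f (a i) * (a i `^ s * powdiag W b s i) <= \sum_i f (a i) * powdiag V m s i.
Proof.
move=> s01; have /andP[s0 s1] := s01.
rewrite -subr_ge0 -sumrB; under eq_bigr do rewrite -mulrBr.
apply: weighted_layer_cake => [i ai|t t0].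
  by rewrite ai powR0 ?gt_eqF// mul0r sandwich_kernel// subrr.
by rewrite sumrB subr_ge0 threshold_lt1.
Qed.

Lemma weighted_gt1 s : 1 < s <= 2 ->
  \sum_i f (a i) * powdiag V m s i <= \sum_i f (a i) * (a i `^ s * powdiag W b s i).
Proof.
move=> s12; have /andP[s1 s2] := s12; have s0 := lt_trans ltr01 s1.
rewrite -subr_ge0 -sumrB; under eq_bigr do rewrite -mulrBr.
apply: weighted_layer_cake => [i ai|t t0].
  by rewrite ai powR0 ?gt_eqF// mul0r sandwich_kernel// subrr.
by rewrite sumrB subr_ge0 threshold_gt1.
Qed.

Lemma weighted_eq1 :
  \sum_i f (a i) * (a i `^ 1 * powdiag W b 1 i) = \sum_i f (a i) * powdiag V m 1 i.
Proof.
apply: eq_bigr => i _; congr (_ * _); rewrite powRr1//.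
rewrite /powdiag; under eq_bigr do rewrite powRr1//.
by under [RHS]eq_bigr do rewrite powRr1 ?m0//; rewrite sandwich_diag.
Qed.

(** By the convention $0^0 = 1$ all the zeroth powers are the identity. *)
Lemma weighted_eq0 :
  \sum_i f (a i) * (a i `^ 0 * powdiag W b 0 i) = \sum_i f (a i) * powdiag V m 0 i.
Proof.
have E (X : 'M[R[i]]_n) c i : X \is unitarymx -> powdiag X c 0 i = 1.
  move=> Xu; rewrite /powdiag; under eq_bigr do rewrite powRr0 mul1r.
  exact: (unitary_col_nsq i (unitary_mulC Xu Uu)).
by apply: eq_bigr => i _; rewrite !E// powRr0 mul1r.
Qed.

End Weighted.
End Threshold.

(** * The two traces in eigenbases, and the trace inequalities *)

Section TraceFormulas.
Variables (R : realType) (n : nat) (s : R) (f : R -> R).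
Variables (U W V : 'M[R[i]]_n) (a b m : 'I_n -> R).
Hypotheses (Uu : U \is unitarymx) (Wu : W \is unitarymx) (Vu : V \is unitarymx).
Hypothesis a0 : forall i, 0 <= a i.

Lemma tr_prod_unidiag : tr_prod s (unidiag U a) (unidiag W b) f =
  (\sum_i f (a i) * (a i `^ s * powdiag U W b s i))%:C.
Proof.
rewrite /tr_prod /mxpowR !(mxfun_unidiag _ _ Uu) (mxfun_unidiag _ _ Wu).
rewrite (unidiagM _ _ Uu) mxtrace_unidiag.
congr (_%:C); apply: eq_bigr => i _; rewrite !mulr_sumr.
by apply: eq_bigr => l _; rewrite /= !mulrA.
Qed.

Lemma tr_sandwich_unidiag :
  unidiag U (fun i => Num.sqrt (a i)) *m unidiag W b *m
    unidiag U (fun i => Num.sqrt (a i)) = unidiag V m ->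
  tr_sandwich s (unidiag U a) (unidiag W b) f =
  (\sum_i f (a i) * powdiag U V m s i)%:C.
Proof.
move=> H.
have E : mxpowR (unidiag U a) 2^-1 = unidiag U (fun i => Num.sqrt (a i)).
  rewrite /mxpowR (mxfun_unidiag _ _ Uu); apply: eq_unidiag => i.
  exact: powR12_sqrt.
rewrite /tr_sandwich E H.
rewrite /mxpowR (mxfun_unidiag _ _ Uu) (mxfun_unidiag _ _ Vu) mxtrace_unidiag.
congr (_%:C); apply: eq_bigr => i _; rewrite !mulr_sumr.
by apply: eq_bigr => l _.
Qed.

End TraceFormulas.

Section Traces.
Variables (R : realType) (n : nat) (s : R).
Variables (A B : 'M[R[i]]_n) (J : interval R) (f : R -> R).

Lemma admissible_traces : admissible A B J f ->
  exists (U W V : 'M[R[i]]_n) (a b m : 'I_n -> R), [/\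
    [/\ U \is unitarymx, W \is unitarymx & V \is unitarymx],
    [/\ forall i, 0 <= a i, forall i, 0 <= b i, forall i, 0 <= f (a i) &
        forall i j, a i <= a j -> f (a i) <= f (a j)],
    unidiag U (fun i => Num.sqrt (a i)) *m unidiag W b *m
      unidiag U (fun i => Num.sqrt (a i)) = unidiag V m,
    tr_prod s A B f = (\sum_i f (a i) * (a i `^ s * powdiag U W b s i))%:C &
    tr_sandwich s A B f = (\sum_i f (a i) * powdiag U V m s i)%:C].
Proof.
move=> [/psdmxP[U [a [Uu a0 ->]]] /psdmxP[W [b [Wu b0 ->]]] specJ fJ0 fmono].
have [V [m [Vu m0 H]]] := unidiag_congrP U W (fun i => Num.sqrt (a i)) b0.
exists U, W, V, a, b, m.
have aJ i : a i \in J.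
  have := specJ (a i)%:C; rewrite /spec /=.
  have -> : eigenvalue (unidiag U a) (a i)%:C.
    by have := cdiag_eigenvalue (crow a) i Uu; rewrite mxE.
  by move=> /(_ isT)[x xJ /complexI <-].
split.
- by split; [exact: Uu|exact: Wu|exact: Vu].
- by split; [exact: a0|exact: b0|move=> i; exact: fJ0|move=> i j; exact: fmono].
- exact: H.
- exact: (tr_prod_unidiag s f a b Uu Wu).
- exact: (tr_sandwich_unidiag s f Uu Vu a0 H).
Qed.

Lemma tr_prod_le_sandwich : 0 <= s <= 1 -> admissible A B J f ->
  tr_prod s A B f <= tr_sandwich s A B f.
Proof.
move=> /andP[s0 s1] /admissible_traces[U [W [V [a [b [m]]]]]].
move=> [[Uu Wu Vu] [a0 b0 f0 fm] H -> ->]; rewrite lecR.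
move: s0; rewrite le_eqVlt => /predU1P[<-|s0]; first by rewrite (weighted_eq0 a b m Uu Wu Vu).
move: s1; rewrite le_eqVlt => /predU1P[->|s1].
  by rewrite (weighted_eq1 Uu Vu a0 b0 H).
by apply: (weighted_lt1 Uu Wu Vu a0 b0 H) => //; rewrite s0.
Qed.

Lemma tr_sandwich_le_prod : 1 <= s <= 2 -> admissible A B J f ->
  tr_sandwich s A B f <= tr_prod s A B f.
Proof.
move=> /andP[s1 s2] /admissible_traces[U [W [V [a [b [m]]]]]].
move=> [[Uu Wu Vu] [a0 b0 f0 fm] H -> ->]; rewrite lecR.
move: s1; rewrite le_eqVlt => /predU1P[<-|s1].
  by rewrite (weighted_eq1 Uu Vu a0 b0 H).
by apply: (weighted_gt1 Uu Wu Vu a0 b0 H) => //; rewrite s1.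
Qed.

End Traces.

(** * The counterexample *)

Lemma nsq_cauchy (R : realType) (I : finType) (u v : I -> R[i]) :
  nsq (\sum_i u i * v i) <= (\sum_i nsq (u i)) * (\sum_i nsq (v i)).
Proof.
suff [] : [/\ 0 <= \sum_i nsq (u i), 0 <= \sum_i nsq (v i) &
  nsq (\sum_i u i * v i) <= (\sum_i nsq (u i)) * (\sum_i nsq (v i))] by [].
elim/big_ind3 : _ => [|S1 P1 Q1 S2 P2 Q2 [p1 q1 h1] [p2 q2 h2]|i _].
- by rewrite nsq0 mulr0.
- split; rewrite ?addr_ge0//.
  have D : nsq (S1 + S2) = nsq S1 + nsq S2 +
      2 * (complex.Re S1 * complex.Re S2 + complex.Im S1 * complex.Im S2).
    by case: (S1) (S2) => [x1 y1] [x2 y2]; rewrite /nsq /=; ring.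
  set X := complex.Re S1 * complex.Re S2 + _ in D.
  have XX : X ^+ 2 <= nsq S1 * nsq S2.
    rewrite -subr_ge0 /X /nsq; case: (S1) (S2) => [x1 y1] [x2 y2] /=.
    set Y := (Z in 0 <= Z).
    have -> : Y = (x1 * y2 - y1 * x2) ^+ 2 by rewrite /Y; ring.
    exact: sqr_ge0.
  have {}XX : X ^+ 2 <= (Q1 * P1) * (Q2 * P2).
    by apply: (le_trans XX); rewrite ler_pM ?nsq_ge0.
  (* The inequality of arithmetic and geometric means for [Q1 * P2] and [Q2 * P1]. *)
  have X2 : (2 * X) ^+ 2 <= (Q1 * P2 + Q2 * P1) ^+ 2.
    have := sqr_ge0 (Q1 * P2 - Q2 * P1); nra.
  have QP : 0 <= Q1 * P2 + Q2 * P1 by rewrite addr_ge0 ?mulr_ge0.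
  have X1 : 2 * X <= Q1 * P2 + Q2 * P1.
    by rewrite (le_trans (ler_norm _))// -ler_sqr ?nnegrE// real_normK ?num_real.
  by rewrite D; nra.
- by split; rewrite ?nsq_ge0// nsqM.
Qed.

Section GenericFacts.
Variables (C : numClosedFieldType) (n : nat).

Lemma mul_cdiag_eigen (U : 'M[C]_n) (d : 'rV[C]_n) (x : 'cV[C]_n) : U \is unitarymx ->
  U *m (cdiag U d *m x) = diag_mx d *m (U *m x).
Proof. by move=> /unitarymxP UU; rewrite /cdiag !mulmxA UU mul1mx. Qed.

Lemma dot_unitary (U : 'M[C]_n) (x y : 'cV[C]_n) : U \is unitarymx ->
  (U *m x)^t* *m (U *m y) = x^t* *m y.
Proof. by move=> Uu; rewrite adjmxM mulmxA -(mulmxA _ _ U) unitarymx_adjK// mulmx1. Qed.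

Lemma cdiag_id (d : 'rV[C]_n) : cdiag 1%:M d = diag_mx d.
Proof. by rewrite /cdiag trmx1 map_mx1 mul1mx mulmx1. Qed.

Lemma unitarymx1 : (1%:M : 'M[C]_n) \is unitarymx.
Proof. by apply/unitarymxP; rewrite trmx1 map_mx1 mulmx1. Qed.

Lemma congr_eigenvector (S A B : 'M[C]_n) (x : 'cV[C]_n) c : S *m S = A ->
  B *m (A *m x) = c *: x -> S *m B *m S *m (S *m x) = c *: (S *m x).
Proof. by move=> <- H; rewrite -!mulmxA (mulmxA S S) H scalemxAr. Qed.

End GenericFacts.

(** Only the part of [x] in the eigenspace for [lam] meets [y], and there the [s]-th power acts as
    [lam ^ s]. Cauchy-Schwarz bounds the overlap, with [w'] keeping just the coordinates where [y]
    is nonzero. *)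
Lemma eigen_moment_le (R : realType) (n : nat) (V : 'M[R[i]]_n) (m : 'I_n -> R)
    (x y : 'cV[R[i]]_n) (lam s : R) :
  V \is unitarymx -> unidiag V m *m y = lam%:C *: y ->
  lam `^ s * nsq ((x^t* *m y) 0 0) <=
  (\sum_l m l `^ s * nsq ((V *m x) l 0)) * \sum_i nsq (y i 0).
Proof.
move=> Vu Hy; set w := V *m x; set c := V *m y.
have Hc l : c l 0 != 0 -> m l = lam.
  have : diag_mx (crow m) *m c = lam%:C *: c.
    by rewrite /c scalemxAr -Hy /unidiag (mul_cdiag_eigen _ _ Vu).
  move: (c) => c' E cl.
  apply: (@complexI R); apply: (mulIf cl); have /colP/(_ l) := E.
  by rewrite mul_diag_mx !mxE.
pose w' l : R[i] := if c l 0 == 0 then 0 else Num.conj (w l 0).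
have -> : (x^t* *m y) 0 0 = \sum_l w' l * c l 0.
  rewrite -(dot_unitary x y Vu) -/w -/c /w'; move: (w) (c) => w1 c1.
  rewrite mxE; apply: eq_bigr => l _; rewrite !mxE.
  by case: eqVneq => [->|]; rewrite ?mulr0.
rewrite -(vnsq_unitary y Vu) -/c.
have := ler_wpM2l (powR_ge0 lam s) (nsq_cauchy w' (fun l => c l 0)).
move/le_trans; apply; rewrite mulrA ler_wpM2r//.
  by apply: sumr_ge0 => l _; exact: nsq_ge0.
rewrite mulr_sumr; apply: ler_sum => l _; rewrite /w'.
case: eqVneq => [_|/Hc ->]; last by rewrite nsqJ.
by rewrite nsq0 mulr0 mulr_ge0 ?nsq_ge0 ?powR_ge0.
Qed.

Section Counterexample.
Variables (R : realType) (beta : R).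
Hypotheses (beta0 : 0 < beta) (beta1 : beta <= 1).

(** Built from the triple 3, 4, 5. The first row, the eigenvector of [A] for 1, is orthogonal to the
    eigenvector of [B] for 1, so its diagonal entry of $B^s$ is only of order $b^s$. *)
Definition frame_entry (i j : nat) : R :=
  nth 0 (nth [::] [:: [:: 0; 3 / 5; 4 / 5];
                      [:: 3 / 5; - (16 / 25); 12 / 25];
                      [:: 4 / 5; 12 / 25; - (9 / 25)]] i) j.

Definition frame : 'M[R[i]]_3 := \matrix_(i, j) (frame_entry i j)%:C.

Lemma sum3E (T : nmodType) (F : 'I_3 -> T) :
  \sum_i F i = F ord0 + (F (lift ord0 ord0) + F (lift ord0 (lift ord0 ord0))).
Proof. by rewrite !big_ord_recl big_ord0 addr0. Qed.

Lemma frame_unitary : frame \is unitarymx.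
Proof.
apply/unitarymxP/matrixP => i j; rewrite !mxE.
transitivity ((\sum_k frame_entry i (k : 'I_3) * frame_entry j k)%:C).
  rewrite rmorph_sum; apply: eq_bigr => k _; rewrite !mxE rmorphM /=.
  by congr (_ * _); exact: conjc_real.
have -> : (i == j)%:R = ((i == j)%:R : R)%:C by rewrite rmorph_nat.
congr (_%:C); rewrite sum3E.
by case: i j => [[|[|[|//]]] ?] [[|[|[|//]]] ?]; rewrite /frame_entry /=; field.
Qed.

Definition eigA (i : 'I_3) : R := nth 0 [:: 1; 2^-1; 0] i.

Let lam : R := 9 / 50 + 24 / 125 * beta.
(* [b] and [lam] are such that [(1, - beta, 0)] is an eigenvector of [B A] for
   the eigenvalue [lam]. *)
Let b : R := lam * beta / (24 / 125 + 353 / 625 * beta).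
Let eigB (i : 'I_3) : R := nth 0 [:: 1; b; 0] i.
Let xi : 'cV[R[i]]_3 := \col_i (nth 0 [:: 1; - beta; 0] (i : 'I_3))%:C.
Let z (i : 'I_3) : R :=
  nth 0 [:: - (3 / 5 * beta); 3 / 5 + 16 / 25 * beta; 4 / 5 - 12 / 25 * beta] i.

Let lam0 : 0 < lam.
Proof. by move: beta0; rewrite /lam; lra. Qed.

Let b_bounds : 0 < b /\ b <= 6 * lam * beta.
Proof.
have d0 : 0 < 24 / 125 + 353 / 625 * beta by move: beta0; lra.
have lb : 0 < lam * beta by rewrite mulr_gt0.
split; first by rewrite divr_gt0.
rewrite /b ler_pdivrMr//; move: beta0 lb; nra.
Qed.

Let eigA_ge0 i : 0 <= eigA i.
Proof. by case: i => [[|[|[|//]]] ?]; rewrite /eigA /=. Qed.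

Let eigB_ge0 i : 0 <= eigB i.
Proof.
have [b0 _] := b_bounds.
by case: i => [[|[|[|//]]] ?]; rewrite /eigB //= ltW.
Qed.

Let frame_xi : frame *m xi = \col_i (z i)%:C.
Proof.
apply/colP => i; rewrite !mxE.
transitivity ((\sum_k frame_entry i (k : 'I_3) * nth 0 [:: 1; - beta; 0] k)%:C).
  by rewrite rmorph_sum; apply: eq_bigr => k _; rewrite !mxE rmorphM.
congr (_%:C); rewrite sum3E.
by case: i => [[|[|[|//]]] ?]; rewrite /frame_entry /z /=; field.
Qed.

Let BA_xi : unidiag 1%:M eigB *m (unidiag frame eigA *m xi) = lam%:C *: xi.
Proof.
rewrite [unidiag frame _ *m _]unidiagE frame_xi /unidiag cdiag_id; apply/colP => l.
rewrite mul_diag_mx !mxE.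
have -> : \sum_j (frame^t*) l j * (diag_mx (crow eigA) *m \col_i (z i)%:C) j 0 =
   (\sum_k frame_entry (k : 'I_3) l * (eigA k * z k))%:C.
  rewrite rmorph_sum; apply: eq_bigr => k _.
  rewrite mul_diag_mx !mxE !rmorphM /=; congr (_ * _); exact: conjc_real.
rewrite -!rmorphM; congr (_%:C); rewrite sum3E.
set d := 24 / 125 + 353 / 625 * beta.
have d0 : d != 0 by rewrite gt_eqF// /d; move: beta0; lra.
have bd : b * d = lam * beta by rewrite /b divfK.
case: l => [[|[|[|//]]] ?]; rewrite /frame_entry /z /eigA /eigB /=.
- by rewrite /lam; field.
- set q := (X in b * X); have -> : q = - d by rewrite /q /d; field.
  by rewrite mulrN bd mulrN.
- by rewrite mul0r mulr0.
Qed.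

Let f (x : R) : R := if 1 <= x then 1 else 0.

Let f_sum (g : 'I_3 -> R) : \sum_i f (eigA i) * g i = g ord0.
Proof.
rewrite sum3E /f /eigA /= lexx mul1r.
have -> : ((1 : R) <= 2^-1) = false by apply/negbTE; rewrite -ltNge; lra.
by rewrite ler10 !mul0r !addr0.
Qed.

Lemma counterexample_admissible :
  admissible (unidiag frame eigA) (unidiag 1%:M eigB) `]-oo, +oo[ f.
Proof.
split.
- exact: psdmx_unidiag.
- exact: psdmx_unidiag.
- move=> w /= /(eigenvalue_cdiag frame_unitary)[i ->]; rewrite mxE.
  by exists (eigA i).
- by move=> x _; rewrite /f; case: ifP.
- move=> x y _ _ xy; rewrite /f; case: ifP => [x1|_]; last by case: ifP.
  by rewrite (le_trans x1 xy).
Qed.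

(** On the eigenvector of [A] for 1, the entry of $B^s$ is of order $\beta^s$, while that of $M^s$
    is at least of order $\beta^2$, the squared overlap with an eigenvector of [M]. The equation for
    [beta] makes $(6\lambda\beta)^s = \lambda^s \beta^2/4$, small enough for the strict
    inequality. *)
Lemma counterexample_lt s : 2 < s -> beta `^ (s - 2) = (4 * 6 `^ s)^-1 ->
  tr_prod s (unidiag frame eigA) (unidiag 1%:M eigB) f <
  tr_sandwich s (unidiag frame eigA) (unidiag 1%:M eigB) f.
Proof.
move=> s2 betaE; have s0 : 0 < s by lra.
have [V [m [Vu m0 H]]] := unidiag_congrP frame 1%:M (fun i => Num.sqrt (eigA i)) eigB_ge0.
rewrite (tr_prod_unidiag s f eigA eigB frame_unitary (unitarymx1 _ _)).
rewrite (tr_sandwich_unidiag s f frame_unitary Vu eigA_ge0 H).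
rewrite ltcR !f_sum.
have -> : eigA ord0 = 1 by [].
rewrite powR1 mul1r.
have -> : powdiag frame 1%:M eigB s ord0 = 9 / 25 * b `^ s.
  rewrite /powdiag sum3E mul1mx !mxE !nsqJ !nsqC /eigB /frame_entry /=.
  by rewrite powR1 powR0 ?gt_eqF//; field.
(* The eigenvector $A^{1/2}\xi$ of [M] for [lam], coming from the eigenvector $\xi$ of $BA$. *)
pose psi := unidiag frame (fun i => Num.sqrt (eigA i)) *m xi.
have SS : unidiag frame (fun i => Num.sqrt (eigA i)) *m
          unidiag frame (fun i => Num.sqrt (eigA i)) = unidiag frame eigA.
  rewrite (unidiagM _ _ frame_unitary); apply: eq_unidiag => i.
  by rewrite -expr2 sqr_sqrtr.
have Mpsi := congr_eigenvector SS BA_xi; rewrite H -/psi in Mpsi.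
(* The unit eigenvector of [A] for the eigenvalue 1, the only one that [f] keeps. *)
pose e := frame^t* *m delta_mx ord0 0 : 'cV[R[i]]_3.
have fpsi : frame *m psi = \col_i (Num.sqrt (eigA i) * z i)%:C.
  rewrite /psi /unidiag (mul_cdiag_eigen _ _ frame_unitary) frame_xi.
  by apply/colP => i; rewrite mul_diag_mx !mxE rmorphM.
have := eigen_moment_le e s Vu Mpsi.
have -> : \sum_l m l `^ s * nsq ((V *m e) l 0) = powdiag frame V m s ord0.
  by apply: eq_bigr => l _; rewrite /e mulmxA -colE [col _ _ _ _]mxE.
set P := powdiag frame V m s ord0.
have P0 : 0 <= P.
  by apply: sumr_ge0 => l _; rewrite mulr_ge0 ?nsq_ge0 ?powR_ge0.
have -> : nsq ((e^t* *m psi) 0 0) = (3 / 5 * beta) ^+ 2.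
  rewrite -(dot_unitary _ _ frame_unitary) fpsi /e mulmxA (unitarymxP frame_unitary).
  rewrite mul1mx mxE (bigD1 ord0)//= big1 => [|k k0].
    by rewrite !mxE /= conjC1 mul1r addr0 nsqC /eigA /z /= sqrtr1 mul1r sqrrN.
  by rewrite !mxE (negbTE k0) /= conjC0 mul0r.
have N : \sum_i nsq (psi i 0) <= 2.
  rewrite -(vnsq_unitary _ frame_unitary) fpsi sum3E !mxE !nsqC !exprMn.
  rewrite !sqr_sqrtr// /eigA /z /=.
  have bb : beta ^+ 2 <= 1 by rewrite expr_le1// ltW.
  by move: beta0 beta1 bb; nra.
move=> HP.
have {}HP : lam `^ s * (3 / 5 * beta) ^+ 2 <= P * 2.
  by apply: (le_trans HP); rewrite ler_wpM2l.
have [b0 bl] := b_bounds.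
have bs : b `^ s <= lam `^ s * beta ^+ 2 / 4.
  apply: (@le_trans _ _ ((6 * lam * beta) `^ s)).
    by apply: ge0_ler_powR; rewrite ?nnegrE ?(ltW s0) ?(ltW b0)
      ?mulr_ge0 ?(ltW lam0) ?(ltW beta0).
  rewrite !powRM ?mulr_ge0 ?(ltW lam0) ?(ltW beta0)//.
  have -> : beta `^ s = beta `^ (s - 2) * beta ^+ 2.
    rewrite -(powR_mulrn 2 (ltW beta0)) -powRD ?subrK//.
    by rewrite (gt_eqF beta0) implybT.
  rewrite betaE le_eqVlt; apply/orP; left; apply/eqP; field.
  by rewrite gt_eqF// powR_gt0.
have L : 0 < lam `^ s * beta ^+ 2 by rewrite mulr_gt0 ?powR_gt0 ?exprn_gt0.
move: HP bs L; rewrite exprMn; set t := lam `^ s * beta ^+ 2.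
have -> : lam `^ s * ((3 / 5) ^+ 2 * beta ^+ 2) = 9 / 25 * t by rewrite /t; field.
lra.
Qed.

End Counterexample.

Lemma counterexample (R : realType) (s : R) : 2 < s ->
  exists (A B : 'M[R[i]]_3) (J : interval R) (f : R -> R),
    admissible A B J f /\ tr_prod s A B f < tr_sandwich s A B f.
Proof.
move=> s2; have s20 : 0 < s - 2 by rewrite subr_gt0.
pose c : R := (4 * 6 `^ s)^-1.
have p1 : 1 <= (6 : R) `^ s by rewrite -[leLHS](powRr0 6) ler_powR//; lra.
have c0 : 0 < c by rewrite invr_gt0; lra.
have c1 : c <= 1 by rewrite invf_le1; lra.
pose beta := c `^ (s - 2)^-1.
have beta0 : 0 < beta by rewrite powR_gt0.
have e1 : (1 : R) `^ (s - 2)^-1 = 1 by rewrite powR1.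
have beta1 : beta <= 1.
  rewrite -[leRHS]e1; apply: ge0_ler_powR; rewrite ?nnegrE ?(ltW c0)//.
  by rewrite invr_ge0 ltW.
have betaE : beta `^ (s - 2) = (4 * 6 `^ s)^-1.
  by rewrite /beta -powRrM mulVf ?gt_eqF// powRr1// ltW.
have adm := counterexample_admissible beta0.
have lt := counterexample_lt beta0 beta1 s2 betaE.
by do 4 eexists; split; [exact: adm|exact: lt].
Qed.

Theorem corollary4p2 (R : realType) :
  [/\ (forall s : R, 1 <= s ->
        ((forall (n : nat) (A B : 'M[R[i]]_n) (J : interval R) (f : R -> R),
            admissible A B J f -> tr_prod s A B f >= tr_sandwich s A B f)
         <-> 1 <= s <= 2)),
      (forall s : R, 0 <= s <= 1 ->
        forall (n : nat) (A B : 'M[R[i]]_n) (J : interval R) (f : R -> R),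
          admissible A B J f -> tr_prod s A B f <= tr_sandwich s A B f),
      (forall s : R, 1 <= s <= 2 ->
        forall (n : nat) (A B : 'M[R[i]]_n) (J : interval R) (f : R -> R),
          admissible A B J f -> tr_prod s A B f >= tr_sandwich s A B f) &
      (forall s : R, 2 < s ->
        exists (A B : 'M[R[i]]_3) (J : interval R) (f : R -> R),
          admissible A B J f /\ tr_prod s A B f < tr_sandwich s A B f)].
Proof.
split.
- move=> s s1; split=> [H|s12 n A B J f]; last exact: tr_sandwich_le_prod.
  rewrite s1 /= leNgt; apply/negP => /counterexample[A [B [J [f [adm lt]]]]].
  by have := lt_le_trans lt (H _ _ _ _ _ adm); rewrite ltxx.
- by move=> s s01 n A B J f; exact: tr_prod_le_sandwich.
- by move=> s s12 n A B J f; exact: tr_sandwich_le_prod.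
- by move=> s; exact: counterexample.
Qed.
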